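(* Let $k,\ell\ge 2$ and let $n=k\ell$. Fix a point $A\in \mathrm{Gr}(k,n)$ all of whose Plücker coordinates are non-zero, and let $\mathcal{T}_A\subset \mathrm{Gr}(k,n)$ be the Zariski closure of the torus orbit $(\mathbb{C}^* )^n\cdot A$. Then the Chow-Lam form of $\mathcal{T}_A$, written in primal Plücker coordinates $B$ on $\mathrm{Gr}(n-\ell,n)$, equals the Segre determinant $\mathrm{Seg}_{k,\ell}(A,B)$ (as polynomials in $B$, up to a non-zero scalar).
   Context: Everything is over $\mathbb{C}$. $\mathrm{Gr}(k,n)$ is the Grassmannian of $k$-dimensional subspaces of $\mathbb{C}^n$. A point $A\in\mathrm{Gr}(k,n)$ is represented as the row span of a $k\times n$ matrix, also called $A$, with columns $A_1,\dots,A_n\in\mathbb{C}^k$. Its (dual) Plücker coordinates are the maximal minors of this matrix. The torus $T=(\mathbb{C}^* )^n$ acts on $\mathrm{Gr}(k,n)$ by scaling the columns of matrix representatives. Primal coordinates on $\mathrm{Gr}(n-\ell,n)$: a point of $\mathrm{Gr}(n-\ell,n)$ is represented as the kernel of an $\ell\times n$ matrix $B$ with columns $B_1,\dots,B_n\in\mathbb{C}^\ell$. The primal Plücker coordinates of this point are the maximal minors $\langle J\rangle$, $J\in\binom{[n]}{\ell}$, of $B$. Segre determinant: for $n=k\ell$, $\mathrm{Seg}_{k,\ell}(A,B)$ is the determinant of the $k\ell\times k\ell$ matrix whose $i$-th column is $A_i\otimes B_i\in\mathbb{C}^k\otimes\mathbb{C}^\ell\cong\mathbb{C}^{k\ell}$.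 For fixed $A$ it is a polynomial in the maximal minors $\langle J\rangle$ of $B$, i.e. an element of the homogeneous coordinate ring of $\mathrm{Gr}(n-\ell,n)$ in primal Plücker coordinates; replacing the matrix representing $A$ changes it by a non-zero scalar. Chow-Lam form: let $\mathcal{V}\subset\mathrm{Gr}(k,n)$ be a projective variety of dimension $k(r-k)-1$ for some $r\le n$. Let $\mathrm{Fl}(k,n-r+k,n)$ be the partial flag variety of pairs ($k$-space contained in an $(n-r+k)$-space) in $\mathbb{C}^n$, with projections $\pi_1$ to $\mathrm{Gr}(k,n)$ and $\pi_2$ to $\mathrm{Gr}(n-r+k,n)$. The Chow-Lam locus $\mathcal{CL}_{\mathcal{V}}$ is the Zariski closure of $\pi_2(\pi_1^{-1}(\mathcal{V}))$ in $\mathrm{Gr}(n-r+k,n)$. If it is a hypersurface, it is defined by a single equation in the Plücker coordinates of $\mathrm{Gr}(n-r+k,n)$ (an element of the homogeneous coordinate ring generating the ideal of the locus, unique up to non-zero scalar), called the Chow-Lam form $CL_{\mathcal{V}}$; if $\mathcal{CL}_{\mathcal{V}}$ is not a hypersurface, one sets $CL_{\mathcal{V}}:=1$. For $\mathcal{V}=\mathcal{T}_A$ of dimension $n-1=k\ell-1$ one has $r=k+\ell$, so the Chow-Lam locus lies in $\mathrm{Gr}(n-\ell,n)$. *)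

(* Defs.v *)
From HB Require Import structures.
From mathcomp Require Import all_boot all_order all_algebra.
From mathcomp Require Import mpoly mxtens complex.
From mathcomp Require Import classical_sets reals.
Set Implicit Arguments.
Unset Strict Implicit.
Unset Printing Implicit Defensive.
Import GRing.Theory.
Local Open Scope ring_scope.
Local Open Scope classical_set_scope.

Definition ksubsets (m n : nat) : {set {set 'I_n}} := [set I : {set 'I_n} | #|I| == m]%SET.

(* The maximal minor of X on the columns in I, in increasing order.  It is
   meant for #|I| = m; other sets I give a junk value. *)
Definition minor (R : comNzRingType) (m n : nat) (X : 'M[R]_(m, n))
    (I : {set 'I_n}) : R :=
  \det (\matrix_(i < m, j < m) nth 0 [seq col a X | a in I] j i 0).

(* Polynomials in the variables p_I, for I an m-subset of {0, ..., n-1}; the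
   variable of index p stands for the subset enum_val p. *)
Notation plucker_poly F m n := {mpoly F[#|ksubsets m n|]}.

Section Grassmannian.
Variable F : fieldType.

Definition Gr (m n : nat) := {U : {vspace 'rV[F]_n} | \dim U == m}.

Definition rowspan (m n : nat) (X : 'M[F]_(m, n)) : {vspace 'rV[F]_n} :=
  limg (linfun (mulmxr X : 'rV[F]_m -> 'rV[F]_n)).

Definition plucker_eval (m n : nat) (f : plucker_poly F m n)
    (X : 'M[F]_(m, n)) : F :=
  f.@[fun p => minor X (enum_val p)].

(* Pluecker coordinates of U are defined up to a common non-zero scalar, all
   of whose values are attained by some representative X.  Over an infinite
   field, a possibly non-homogeneous f thus vanishes at U in the sense below
   iff each of its homogeneous components does. *)
Definition vanishes_at (m n : nat) (f : plucker_poly F m n) (U : Gr m n) :=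
  forall X : 'M[F]_(m, n), rowspan X = val U -> plucker_eval f X = 0.

Definition vanishing_ideal (m n : nat) (S : set (Gr m n)) :
    set (plucker_poly F m n) :=
  [set f | forall U, S U -> vanishes_at f U].

(* Equality in the homogeneous coordinate ring of Gr m n, which is the quotient
   of the polynomial ring by the ideal of the Pluecker relations. *)
Definition coord_eq (m n : nat) (f g : plucker_poly F m n) :=
  vanishing_ideal [set: Gr m n] (f - g).

Definition zclosure (m n : nat) (S : set (Gr m n)) : set (Gr m n) :=
  [set U | forall f, vanishing_ideal S f -> vanishes_at f U].

Definition zclosed (m n : nat) (S : set (Gr m n)) := zclosure S = S.

Definition irreducible_closed (m n : nat) (W : set (Gr m n)) :=
  [/\ zclosed W, W !=set0 &
    forall Z1 Z2 : set (Gr m n), zclosed Z1 -> zclosed Z2 ->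
      W `<=` Z1 `|` Z2 -> W `<=` Z1 \/ W `<=` Z2].

Definition irreducible_component (m n : nat) (Z W : set (Gr m n)) :=
  [/\ irreducible_closed W, W `<=` Z &
    forall W', irreducible_closed W' -> W' `<=` Z -> W `<=` W' -> W' = W].

(* Codimension via chains of irreducible closed subsets, Gr m n itself being
   irreducible. *)
Definition codim_one (m n : nat) (W : set (Gr m n)) :=
  [/\ irreducible_closed W, W <> setT &
    forall W', irreducible_closed W' -> W `<=` W' -> W' = W \/ W' = setT].

Definition hypersurface (m n : nat) (Z : set (Gr m n)) :=
  [/\ zclosed Z, Z !=set0 &
    forall W, irreducible_component Z W -> codim_one W].

(* The image of V under the flag correspondence
   Gr k n <- Fl(k, n-r+k, n) -> Gr (n-r+k) n, then its closure. *)
Definition chow_lam_locus (k r n : nat) (V : set (Gr k n)) :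
    set (Gr (n - r + k) n) :=
  zclosure [set W : Gr (n - r + k) n |
    exists2 U : Gr k n, V U & (val U <= val W)%VS].

(* f represents the Chow-Lam form of V, which is an element of the homogeneous
   coordinate ring, well-defined up to a non-zero scalar. *)
Definition is_chow_lam_form (k r n : nat) (V : set (Gr k n))
    (f : plucker_poly F (n - r + k) n) :=
  (hypersurface (chow_lam_locus (r := r) V) /\
   forall g, vanishing_ideal (chow_lam_locus (r := r) V) g <->
     exists q, coord_eq g (q * f))
  \/ (~ hypersurface (chow_lam_locus (r := r) V) /\ coord_eq f 1).

Definition torus_orbit (k n : nat) (A : 'M[F]_(k, n)) : set (Gr k n) :=
  [set U | exists2 t : 'rV[F]_n,
    (forall i, t 0 i != 0) & val U = rowspan (A *m diag_mx t)].

Definition torus_orbit_closure (k n : nat) (A : 'M[F]_(k, n)) : set (Gr k n) :=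
  zclosure (torus_orbit A).

End Grassmannian.

Definition inversions (n : nat) (I : {set 'I_n}) : nat :=
  #|[set ij : 'I_n * 'I_n |
       [&& ij.1 \in I, ij.2 \notin I & (ij.2 < ij.1)%N]]%SET|.

(* If B has l rows, #|I| + l = n and X is a matrix of full rank whose row span
   is the kernel of B, then the minors of X on the sets I are, up to a common
   scalar, the following signed minors of B on the complements. *)
Definition primal_coord (R : comNzRingType) (l n : nat) (B : 'M[R]_(l, n))
    (I : {set 'I_n}) : R :=
  (-1) ^+ inversions I * minor B (~: I)%SET.

Definition generic_matrix (R : comNzRingType) (l n : nat) :
    'M[{mpoly R[l * n]}]_(l, n) :=
  \matrix_(i < l, j < n) 'X_(mxvec_index i j).

(* An element f of the coordinate ring of Gr m n written in primal coordinates,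
   as a polynomial in the entries of an l x n matrix B with l = n - m; the
   maximal minors of B generate a copy of the coordinate ring in {mpoly R[l * n]}. *)
Definition in_primal_coords (R : comNzRingType) (l m n : nat)
    (f : plucker_poly R m n) : {mpoly R[l * n]} :=
  f \mPo [tuple primal_coord (generic_matrix R l n) (enum_val p)
            | p < #|ksubsets m n|].

Definition segre_det (R : comNzRingType) (k l : nat) (A : 'M[R]_(k, k * l))
    (B : 'M[R]_(l, k * l)) : R :=
  \det (\matrix_(p < k * l, i < k * l) (col i A *t col i B) p 0).

Definition segre_poly (R : comNzRingType) (k l : nat) (A : 'M[R]_(k, k * l)) :
    {mpoly R[l * (k * l)]} :=
  segre_det (map_mx (@mpolyC (l * (k * l)) R) A) (generic_matrix R l (k * l)).

(* Main.v *)
(** Write W = ker B and let seg B be the determinant of the matrix with columns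
    A_i (x) B_i.  A torus translate A diag(t) has its row span in W iff t is in
    the kernel of that matrix.  The relations
    p_(I-j+i) p_(I-j'+i') = p_(I-j+i') p_(I-j'+i) between normalized coordinates
    show that a point of the closure of the orbit contains the row span of some
    A diag(t) with t <> 0, so seg vanishes on the whole Chow-Lam locus.

    Conversely let G vanish at every B with a kernel vector t in the torus.  Then
    G vanishes at each zero of seg where some derivative of seg in a single
    column is non-zero: move that column so that seg stays zero, and check by
    colouring arguments that the kernel vector given by Cramer's rule has
    generically no zero entry.  Restricted to a line B + s C with seg C <> 0,
    seg is, up to a constant, a characteristic polynomial in s which is
    generically separable; the remainder of G modulo this monic polynomial has
    too many roots, so seg divides G.  For G in the subring generated by the
    maximal minors the quotient is semi-invariant under GL_l, hence lies in that
    subring by the first fundamental theorem, and so does seg itself.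

    The locus is irreducible because the pairs (B, t) are parametrized by an
    affine space, and it has codimension one because its ideal is principal.
    Two generators differ by a unit of a polynomial ring, that is, a scalar. *)
Require Import Defs.
From HB Require Import structures.
From mathcomp Require Import all_boot all_order all_fingroup all_algebra.
From mathcomp Require Import mpoly mxtens complex classical_sets reals.
From mathcomp Require Import finset separable ring.
Set Implicit Arguments.
Unset Strict Implicit.
Unset Printing Implicit Defensive.
Import Order.TTheory GRing.Theory Num.Theory.
Local Open Scope ring_scope.

(** * Polynomial functions on matrices *)

Lemma poly_eq0_of_horner (F : numFieldType) (p : {poly F}) :
  (forall s, s != 0 -> p.[s] = 0) -> p = 0.
Proof.
move=> p0; apply/eqP/negPn/negP => nzp.
have := max_poly_roots nzp (rs := [seq i.+1%:R | i <- iota 0 (size p)]).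
rewrite size_map size_iota ltnn => H; apply: notF; apply: H.
  by apply/allP => _ /mapP[i _ ->]; rewrite rootE p0 // pnatr_eq0.
rewrite map_inj_uniq ?iota_uniq // => i j /eqP.
by rewrite eqr_nat eqSS => /eqP.
Qed.

Lemma rmorph_mmap (n : nat) (R S T : comNzRingType) (f : {rmorphism R -> S})
    (h : 'I_n -> S) (g : {rmorphism S -> T}) (p : {mpoly R[n]}) :
  g (mmap f h p) = mmap (g \o f) (g \o h) p.
Proof.
rewrite /mmap rmorph_sum; apply: eq_bigr => m _; rewrite rmorphM /mmap1 /=.
by congr (_ * _); rewrite rmorph_prod; apply: eq_bigr => i _; rewrite rmorphXn.
Qed.

Lemma mmap_meval (n : nat) (R : comNzRingType) (g : R -> R) (h : 'I_n -> R)
    (p : {mpoly R[n]}) : g =1 id -> mmap g h p = p.@[h].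
Proof. by move=> gid; apply: eq_bigr => m _; rewrite gid. Qed.

Lemma mpoly_ring_ind (n : nat) (R : comNzRingType) (P : {mpoly R[n]} -> Prop) :
  (forall c, P c%:MP) -> (forall i, P 'X_i) ->
  (forall p q, P p -> P q -> P (p + q)) ->
  (forall p q, P p -> P q -> P (p * q)) -> forall p, P p.
Proof.
move=> PC PX PD PM p; rewrite [p]mpolyE.
apply: big_ind; [by rewrite -mpolyC0 | exact: PD | move=> m _].
rewrite -mul_mpolyC; apply/PM => //; rewrite mpolyXE_id.
apply: big_ind; [by rewrite -mpolyC1 | exact: PM | move=> i _].
elim: (m i) => [|a IH]; first by rewrite expr0 -mpolyC1.
by rewrite exprS; apply: PM.
Qed.

Lemma meval_at0 (n : nat) (R : comNzRingType) (p : {mpoly R[n]}) :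
  p.@[fun=> 0] = p@_0.
Proof.
elim/mpoly_ring_ind: p => [c|i|p q IHp IHq|p q IHp IHq].
- by rewrite mevalC mcoeffC eqxx mulr1.
- rewrite mevalXU mcoeffX; case: eqP => // /mnmP/(_ i).
  by rewrite mnm1E eqxx mnm0E.
- by rewrite mevalD mcoeffD IHp IHq.
- by rewrite mevalM rmorphM IHp IHq.
Qed.

(** [D] is any derivation that kills the image of [f]. It stays abstract because it is used both for
    [deriv] on univariate polynomials and for a partial derivative on multivariate ones. *)
Lemma mmap_chain_rule (n : nat) (R S : comNzRingType) (f : {rmorphism R -> S})
    (h : 'I_n -> S) (D : {additive S -> S}) (p : {mpoly R[n]}) :
  (forall a b, D (a * b) = D a * b + a * D b) -> (forall c, D (f c) = 0) ->
  D (mmap f h p) = \sum_j mmap f h p^`M(j) * D (h j).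
Proof.
move=> DM DC; elim/mpoly_ring_ind: p => [c|i|p q IHp IHq|p q IHp IHq].
- rewrite mmapC DC big1 // => j _; by rewrite mderivC mmap0 mul0r.
- rewrite mmapX mmap1U (bigD1 i) //= big1 => [|j /negPf nji].
    rewrite addr0 mderivX mnm1E eqxx scale1r -[X in (X - U_(i))%MM]add0m addmK.
    by rewrite mpolyX0 rmorph1 mul1r.
  by rewrite mderivX mnm1E eq_sym nji scale0r mmap0 mul0r.
- rewrite mmapD raddfD IHp IHq -big_split; apply: eq_bigr => j _.
  by rewrite mderivD mmapD mulrDl.
- rewrite rmorphM DM /= IHp IHq mulr_suml mulr_sumr -big_split.
  apply: eq_bigr => j _; rewrite mderivM mmapD !rmorphM mulrDl /=.
  by rewrite mulrAC mulrA.
Qed.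

Section Vanishing.
Variable F : numFieldType.

(** Restrict p to the line through v in the i-th direction: the univariate polynomial obtained has
    infinitely many roots, hence is zero, and its derivative at 0 is the partial derivative at v. *)
Lemma mderiv_vanishing (n : nat) (i : 'I_n) (p : {mpoly F[n]}) :
  (forall v, p.@[v] = 0) -> forall v, p^`M(i).@[v] = 0.
Proof.
move=> p0 v; pose h j : {poly F} := (v j)%:P + (j == i)%:R *: 'X.
have hv j s : (h j).[s] = v j + (j == i)%:R * s by rewrite !hornerE.
have hz : mmap polyC h p = 0.
  apply: poly_eq0_of_horner => s _; rewrite -horner_evalE rmorph_mmap /=.
  by rewrite mmap_meval ?p0 // => c /=; rewrite horner_evalE hornerC.
have := mmap_chain_rule (f := @polyC F) h (D := @deriv F) p (@derivM F) (@derivC F).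
rewrite hz raddf0 => /(congr1 (horner_eval 0)); rewrite rmorph0 rmorph_sum.
rewrite (bigD1 i) //= big1 ?addr0 => [|j /negPf nji].
  rewrite rmorphM rmorph_mmap /= derivD derivC derivZ derivX eqxx scale1r add0r.
  rewrite rmorph1 mulr1 mmap_meval => [|c /=]; last by rewrite horner_evalE hornerC.
  move=> e; apply/esym; rewrite {1}e; apply: meval_eq => j.
  by rewrite /= horner_evalE hv mulr0 addr0.
by rewrite derivD derivC derivZ nji scale0r addr0 mulr0 rmorph0.
Qed.

(** Taylor expansion at 0: all iterated derivatives vanish there, and in characteristic zero they
    are the coefficients up to non-zero factorials. *)
Lemma mpoly_eq0_of_meval (n : nat) (p : {mpoly F[n]}) :
  (forall v, p.@[v] = 0) -> p = 0.
Proof.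
move=> p0; have dp0 m v : p^`M[m].@[v] = 0.
  rewrite mderivm_foldr; elim: (flatten _) v => [|i s IH] v //=.
  by apply: mderiv_vanishing.
apply/mpolyP => m; rewrite mcoeff0.
have := dp0 m (fun=> 0); rewrite meval_at0 mcoeff_mderivm addm0 => /eqP.
rewrite mulrn_eq0 => /orP[|/eqP //].
rewrite -leqn0 leqNgt prodn_gt0 // => i.
by rewrite ffactnn fact_gt0.
Qed.

Lemma mpoly_eq_of_meval (n : nat) (p q : {mpoly F[n]}) :
  (forall v, p.@[v] = q.@[v]) -> p = q.
Proof.
move=> pq; apply/eqP; rewrite -subr_eq0; apply/eqP/mpoly_eq0_of_meval => v.
by rewrite mevalB pq subrr.
Qed.

Section PolyFun.
Variables a b : nat.
Implicit Types f g : 'M[F]_(a, b) -> F.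

Definition mxeval (p : {mpoly F[a * b]}) (B : 'M_(a, b)) : F := p.@[mxvec B 0].

Lemma mxeval_eq (p q : {mpoly F[a * b]}) : mxeval p =1 mxeval q -> p = q.
Proof.
move=> pq; apply: mpoly_eq_of_meval => v; have := pq (vec_mx (\row_i v i)).
rewrite /mxeval vec_mxK; set v' := _ 0 => e.
have ev : v' =1 v by move=> i; rewrite /v' mxE.
by rewrite -(meval_eq _ ev) e (meval_eq _ ev).
Qed.

(** Polynomiality is a property of functions, so that it passes through determinants, products and
    substitutions while identities are checked pointwise. *)
Definition polyfun f := exists p, forall B, f B = mxeval p B.

Lemma polyfun_mxeval (p : {mpoly F[a * b]}) : polyfun (mxeval p).
Proof. by exists p. Qed.

Lemma eq_polyfun f g : f =1 g -> polyfun f -> polyfun g.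
Proof. by move=> fg [p pE]; exists p => B; rewrite -fg. Qed.

Lemma polyfun_cst (c : F) : polyfun (fun=> c).
Proof. by exists c%:MP => B; rewrite /mxeval mevalC. Qed.

Lemma polyfun_entry i j : polyfun (fun B => B i j).
Proof. by exists 'X_(mxvec_index i j) => B; rewrite /mxeval mevalXU mxvecE. Qed.

Lemma polyfunD f g : polyfun f -> polyfun g -> polyfun (fun B => f B + g B).
Proof.
by move=> [p pE] [q qE]; exists (p + q) => B; rewrite pE qE /mxeval mevalD.
Qed.

Lemma polyfunM f g : polyfun f -> polyfun g -> polyfun (fun B => f B * g B).
Proof.
by move=> [p pE] [q qE]; exists (p * q) => B; rewrite pE qE /mxeval mevalM.
Qed.

Lemma polyfunN f : polyfun f -> polyfun (fun B => - f B).
Proof. by move=> [p pE]; exists (- p) => B; rewrite pE /mxeval mevalN. Qed.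

Lemma polyfunB f g : polyfun f -> polyfun g -> polyfun (fun B => f B - g B).
Proof. by move=> pf pg; apply/polyfunD/polyfunN. Qed.

Lemma polyfun_sum (I : Type) (r : seq I) (P : pred I) (f : I -> 'M_(a, b) -> F) :
  (forall i, polyfun (f i)) -> polyfun (fun B => \sum_(i <- r | P i) f i B).
Proof.
move=> pf; elim: r => [|i r IH].
  by apply: eq_polyfun (polyfun_cst 0) => B; rewrite big_nil.
case Pi: (P i).
  by apply: eq_polyfun (polyfunD (pf i) IH) => B; rewrite big_cons Pi.
by apply: eq_polyfun IH => B; rewrite big_cons Pi.
Qed.

Lemma polyfun_prod (I : Type) (r : seq I) (P : pred I) (f : I -> 'M_(a, b) -> F) :
  (forall i, polyfun (f i)) -> polyfun (fun B => \prod_(i <- r | P i) f i B).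
Proof.
move=> pf; elim: r => [|i r IH].
  by apply: eq_polyfun (polyfun_cst 1) => B; rewrite big_nil.
case Pi: (P i).
  by apply: eq_polyfun (polyfunM (pf i) IH) => B; rewrite big_cons Pi.
by apply: eq_polyfun IH => B; rewrite big_cons Pi.
Qed.

Lemma polyfunX f e : polyfun f -> polyfun (fun B => f B ^+ e).
Proof.
move=> pf; elim: e => [|e IH]; first exact: polyfun_cst.
by apply: eq_polyfun (polyfunM pf IH) => B; rewrite exprS.
Qed.

Lemma polyfun_mulmx (p q r : nat) (M : 'M_(a, b) -> 'M[F]_(p, q))
    (N : 'M_(a, b) -> 'M[F]_(q, r)) :
  (forall i j, polyfun (fun B => M B i j)) ->
  (forall i j, polyfun (fun B => N B i j)) ->
  forall i j, polyfun (fun B => (M B *m N B) i j).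
Proof.
move=> pM pN i j; have H k := polyfunM (pM i k) (pN k j).
by apply: eq_polyfun (polyfun_sum _ _ H) => B; rewrite mxE.
Qed.

Lemma polyfun_det (p : nat) (M : 'M_(a, b) -> 'M[F]_p) :
  (forall i j, polyfun (fun B => M B i j)) -> polyfun (fun B => \det (M B)).
Proof.
move=> pM; apply: polyfun_sum => s; apply: polyfunM; first exact: polyfun_cst.
exact: polyfun_prod.
Qed.

Lemma polyfun_meval (n : nat) (p : {mpoly F[n]}) (h : 'M_(a, b) -> 'I_n -> F) :
  (forall i, polyfun (h^~ i)) -> polyfun (fun B => p.@[h B]).
Proof.
move=> ph; elim/mpoly_ring_ind: p => [c|i|p q IHp IHq|p q IHp IHq].
- by apply: eq_polyfun (polyfun_cst c) => B; rewrite mevalC.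
- by apply: eq_polyfun (ph i) => B; rewrite mevalXU.
- by apply: eq_polyfun (polyfunD IHp IHq) => B; rewrite mevalD.
- by apply: eq_polyfun (polyfunM IHp IHq) => B; rewrite mevalM.
Qed.

(** The density argument used throughout: since polynomials form an integral domain, an identity
    need only be checked where some non-zero polynomial g does not vanish. *)
Lemma polyfun_mul_eq0 f g : polyfun f -> polyfun g ->
  (forall B, f B * g B = 0) -> (exists B, g B != 0) -> forall B, f B = 0.
Proof.
move=> [p pE] [q qE] fg0 [B0 gB0] B.
have /eqP : p * q = 0.
  apply: mxeval_eq => X; transitivity (f X * g X).
    by rewrite pE qE /mxeval mevalM.
  by rewrite fg0 /mxeval meval0.
rewrite mulf_eq0 => /orP[] /eqP e; first by rewrite pE e /mxeval meval0.
by case/eqP: gB0; rewrite qE e /mxeval meval0.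
Qed.

End PolyFun.

Lemma polyfun_comp (a b c d : nat) (g : 'M[F]_(c, d) -> F)
    (M : 'M_(a, b) -> 'M[F]_(c, d)) :
  polyfun g -> (forall i j, polyfun (fun B => M B i j)) ->
  polyfun (fun B => g (M B)).
Proof.
move=> [p pE] pM; have H : polyfun (fun B => p.@[mxvec (M B) 0]).
  apply: polyfun_meval => i; case/mxvec_indexP: i => i j.
  by apply: eq_polyfun (pM i j) => B; rewrite mxvecE.
by apply: eq_polyfun H => B; rewrite pE.
Qed.

End Vanishing.

(** * Maximal minors and duality *)

(** The increasing enumeration of I, indexed by ['I_m] so that a minor is the determinant of a
    [colsub]. *)
Definition setsel (m n : nat) (I : {set 'I_n}) (hI : #|I| = m) (j : 'I_m) : 'I_n :=
  enum_val (cast_ord (esym hI) j).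

Lemma setsel_inj (m n : nat) (I : {set 'I_n}) (hI : #|I| = m) :
  injective (setsel hI).
Proof. by move=> i j /enum_val_inj/cast_ord_inj. Qed.

Lemma setsel_in (m n : nat) (I : {set 'I_n}) (hI : #|I| = m) j :
  setsel hI j \in I.
Proof. exact: enum_valP. Qed.

Lemma setsel_onto (m n : nat) (I : {set 'I_n}) (hI : #|I| = m) i :
  i \in I -> exists j, i = setsel hI j.
Proof.
move=> iI; exists (cast_ord hI (enum_rank_in iI i)).
by rewrite /setsel cast_ordK enum_rankK_in.
Qed.

Lemma setsel_lt (m n : nat) (I : {set 'I_n}) (hI : #|I| = m) (i j : 'I_m) :
  (i < j)%N -> (setsel hI i < setsel hI j)%N.
Proof.
move=> ij; have S : sorted ltn [seq val a | a <- enum I].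
  rewrite sorted_map /enum_mem; apply: sorted_filter.
    by move=> x y z; apply: ltn_trans.
  by rewrite -enumT -sorted_map val_enum_ord iota_ltn_sorted.
have x0 : 'I_n := setsel hI i.
have sz : size [seq val a | a <- enum I] = m by rewrite size_map -cardE.
have nthE (a : 'I_m) : nat_of_ord (setsel hI a) = nth 0%N [seq val a | a <- enum I] a.
  by rewrite /setsel (enum_val_nth x0) (nth_map x0) // -cardE hI.
by rewrite !nthE (sorted_ltn_nth ltn_trans) // inE sz.
Qed.

Lemma minorE (R : comNzRingType) (m n : nat) (X : 'M[R]_(m, n))
    (I : {set 'I_n}) (hI : #|I| = m) :
  minor X I = \det (colsub (setsel hI) X).
Proof.
rewrite /minor; congr (\det _); apply/matrixP => i j; rewrite !mxE.
have -> : nat_of_ord j = cast_ord (esym hI) j by [].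
by rewrite nth_image mxE.
Qed.

Lemma minor_mulmx (R : comNzRingType) (m n : nat) (Y : 'M[R]_m)
    (X : 'M[R]_(m, n)) (I : {set 'I_n}) :
  #|I| = m -> minor (Y *m X) I = \det Y * minor X I.
Proof.
move=> hI; rewrite !(minorE _ hI) -det_mulmx; congr (\det _).
by apply/matrixP => i j; rewrite !mxE; apply: eq_bigr => a _; rewrite !mxE.
Qed.

Lemma det_col_perm (R : comNzRingType) (n : nat) (s : 'S_n) (X : 'M[R]_n) :
  \det (col_perm s X) = (-1) ^+ s * \det X.
Proof. by rewrite col_permE det_mulmx det_perm odd_permV mulrC. Qed.

(** The sign is that of the permutation sorting the values of f. *)
Lemma det_colsub_minor (R : comNzRingType) (m n : nat) (f : 'I_m -> 'I_n) :
  injective f -> exists (I : {set 'I_n}) (b : bool), #|I| = m /\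
    forall X : 'M[R]_(m, n), \det (colsub f X) = (-1) ^+ b * minor X I.
Proof.
move=> fI; pose I := [set f j | j : 'I_m]%SET.
have hI : #|I| = m by rewrite card_imset // card_ord.
have fin j : f j \in I by apply: imset_f.
pose g j := cast_ord hI (enum_rank_in (fin j) (f j)).
have fg j : setsel hI (g j) = f j by rewrite /setsel cast_ordK enum_rankK_in.
have gI : injective g by move=> i j e; apply: fI; rewrite -!fg e.
exists I, (perm gI); split=> // X; rewrite (minorE _ hI) -det_col_perm.
by congr (\det _); apply/matrixP => i j; rewrite !mxE permE fg.
Qed.

Lemma det_colsub_noninj (R : comNzRingType) (m n : nat) (f : 'I_m -> 'I_n)
    (X : 'M[R]_(m, n)) : ~ injective f -> \det (colsub f X) = 0.
Proof.
move=> nf; have : ~~ injectiveb f by apply/negP => /injectiveP.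
case/injectivePn => i [j nij fij].
rewrite -det_tr; apply: (determinant_alternate nij) => a.
by rewrite !mxE fij.
Qed.

(** Coordinates indexed by arbitrary maps: sorting signs and the zeros due to repeated columns are
    hidden in the polynomial. *)
Lemma plucker_poly_colsub (F : fieldType) (m n : nat) (f : 'I_m -> 'I_n) :
  exists p : plucker_poly F m n,
    forall X, plucker_eval p X = \det (colsub f X).
Proof.
case: (injectiveP f) => [fI|nf].
  have [I [b [hI E]]] := det_colsub_minor F fI.
  have Ik : I \in ksubsets m n by rewrite inE hI.
  exists ((-1) ^+ b *: 'X_(enum_rank_in Ik I)) => X.
  by rewrite /plucker_eval mevalZ mevalXU enum_rankK_in // E.
by exists 0 => X; rewrite /plucker_eval meval0 det_colsub_noninj.
Qed.

Definition primal_eval (F : fieldType) (l m n : nat) (f : plucker_poly F m n)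
    (B : 'M[F]_(l, n)) : F :=
  f.@[fun p => primal_coord B (enum_val p)].

Lemma primal_poly_colsub (F : fieldType) (l m n : nat) (f : 'I_l -> 'I_n) :
  (m + l = n)%N -> exists p : plucker_poly F m n,
    forall B, primal_eval p B = \det (colsub f B).
Proof.
move=> mln; case: (injectiveP f) => [fI|nf].
  have [I [b [hI E]]] := det_colsub_minor F fI.
  have Ik : (~: I)%SET \in ksubsets m n.
    by rewrite inE cardsCs setCK hI card_ord -mln addnK.
  (* The first sign comes from sorting f, the second cancels the one in [primal_coord]. *)
  exists ((-1) ^+ b * (-1) ^+ inversions (~: I)%SET
    *: 'X_(enum_rank_in Ik (~: I)%SET)) => B.
  rewrite /primal_eval mevalZ mevalXU enum_rankK_in // E /primal_coord setCK.
  by rewrite mulrA -(mulrA _ _ ((-1) ^+ inversions _)) -expr2 sqrr_sign mulr1.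
by exists 0 => B; rewrite /primal_eval meval0 det_colsub_noninj.
Qed.

(* Both sides are the sign by which permuting the nodes 0, 1, 2, ... by [s]
   changes the Vandermonde determinant. *)
Lemma sign_perm_inversions (R : pzRingType) (n : nat) (s : 'S_n) :
  (-1) ^+ s = (-1) ^+ #|[set ij : 'I_n * 'I_n |
    (ij.1 < ij.2)%N && (s ij.2 < s ij.1)%N]%SET| :> R.
Proof.
suff E : (-1) ^+ s = (-1) ^+ #|[set ij : 'I_n * 'I_n |
    (ij.1 < ij.2)%N && (s ij.2 < s ij.1)%N]%SET| :> rat.
  move: E; rewrite -[in X in _ = X -> _]signr_odd -[in X in _ -> _ = X]signr_odd.
  by case: (odd _); case: (odd_perm s).
pose a : 'rV[rat]_n := \row_j (j%:R).
have : Vandermonde n (col_perm s a) = col_perm s (Vandermonde n a).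
  by apply/matrixP => i j; rewrite !mxE.
move/(congr1 (Num.sg \o determinant)); rewrite /= det_col_perm sgrM.
have -> : Num.sg ((-1) ^+ s) = (-1) ^+ s :> rat.
  by case: (odd_perm s); rewrite ?expr0 ?expr1 ?sgr1 ?sgrN1.
rewrite !det_Vandermonde !pair_big_dep /=.
set V := \prod_(p : 'I_n * 'I_n | (p.1 < p.2)%N) (a 0 p.2 - a 0 p.1).
have -> : Num.sg V = 1.
  by apply/gtr0_sg/prodr_gt0 => -[i j] /= ij; rewrite !mxE subr_gt0 ltr_nat.
rewrite mulr1 => <-; rewrite (big_morph _ (@sgrM _) (@sgr1 _)).
rewrite -sum1_card (big_morph (fun e => (-1) ^+ e) (@exprD _ _) (expr0 _)).
rewrite [RHS]big_mkcond [LHS]big_mkcond; apply: eq_bigr => -[i j] _.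
rewrite inE /= !mxE; case: ltnP => //= ij; case: ltnP => sij.
  by rewrite ltr0_sg ?expr1 // subr_lt0 ltr_nat.
rewrite gtr0_sg // subr_gt0 ltr_nat ltn_neqAle sij andbT.
by apply: contraTneq ij => /val_inj/perm_inj ->; rewrite ltnn.
Qed.

(** * Complementary minors of a matrix and of its annihilator *)

Section Duality.
Variables (m l : nat).

Section Shuffle.
Variables (I : {set 'I_(m + l)}) (hI : #|I| = m).

Lemma card_setC_ord : #|(~: I)%SET| = l.
Proof. by rewrite cardsCs setCK hI card_ord addKn. Qed.

(** Lists I in increasing order, then its complement in increasing order. *)
Definition shuffle_fun (i : 'I_(m + l)) : 'I_(m + l) :=
  match fintype.split i with
  | inl j => setsel hI j
  | inr j => setsel card_setC_ord j
  end.

Lemma shuffle_inj : injective shuffle_fun.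
Proof.
move=> i j; rewrite /shuffle_fun.
case: (split_ordP i) => a ->; case: (split_ordP j) => b -> /= e.
- by rewrite (setsel_inj e).
- by have := setsel_in card_setC_ord b; rewrite inE -e setsel_in.
- by have := setsel_in card_setC_ord a; rewrite inE e setsel_in.
- by rewrite (setsel_inj e).
Qed.

Definition shuffle : 'S_(m + l) := perm shuffle_inj.

Lemma shuffleL j : shuffle (lshift l j) = setsel hI j.
Proof. by rewrite permE /shuffle_fun (unsplitK (inl j)). Qed.

Lemma shuffleR j : shuffle (rshift m j) = setsel card_setC_ord j.
Proof. by rewrite permE /shuffle_fun (unsplitK (inr j)). Qed.

(** The shuffle is increasing on each of its two blocks, so an inverted pair has one index in each;
    these are the pairs counted by [inversions I]. *)
Lemma sign_shuffle (R : pzRingType) :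
  (-1) ^+ shuffle = (-1) ^+ inversions I :> R.
Proof.
rewrite sign_perm_inversions; congr (_ ^+ _).
pose ss (ij : 'I_(m + l) * 'I_(m + l)) := (shuffle ij.1, shuffle ij.2).
have ssI : injective ss by move=> [i j] [i' j'] [] /perm_inj -> /perm_inj ->.
rewrite -(card_imset _ ssI) /inversions; apply: eq_card => -[x y].
rewrite !inE /=; apply/imsetP/and3P.
  case=> -[i j]; rewrite inE /= => /andP[ij sij] [-> ->]; move: ij sij.
  case: (split_ordP i) => a ->; case: (split_ordP j) => b ->.
  - by rewrite !shuffleL => /(setsel_lt hI)/ltnW; rewrite leqNgt => /negPf ->.
  - rewrite shuffleL shuffleR => _ lt; split=> //; first exact: setsel_in.
    by have := setsel_in card_setC_ord b; rewrite inE.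
  - by move=> /ltnW; rewrite leqNgt /= ltn_addr.
  - rewrite !shuffleR /= ltn_add2l => /(setsel_lt card_setC_ord)/ltnW.
    by rewrite leqNgt => /negPf ->.
case=> /(setsel_onto hI) => -[a ->] yI lt.
have [b yb] : exists b, y = setsel card_setC_ord b by apply: setsel_onto; rewrite inE.
exists (lshift l a, rshift m b); last by rewrite /ss /= shuffleL shuffleR yb.
by rewrite inE /= shuffleL shuffleR -yb lt andbT; apply: ltn_addr (ltn_ord a).
Qed.

End Shuffle.

(* Multiply [col_mx X E], with E the unit rows indexed by the complement of I,
   by the invertible matrix [row_mx P B^T], P a right inverse of X. *)
Lemma primal_coord_minor_add (F : fieldType) (X : 'M[F]_(m, m + l))
    (B : 'M[F]_(l, m + l)) :
  row_free X -> row_free B -> B *m X^T = 0 ->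
  exists2 c : F, c != 0 &
    forall I : {set 'I_(m + l)}, #|I| = m -> primal_coord B I = c * minor X I.
Proof.
move=> /row_freeP[P XP] /row_freeP[Q BQ] BX.
have XB : X *m B^T = 0 by rewrite -[X]trmxK -trmx_mul BX trmx0.
pose N := row_mx P B^T; exists (\det N) => [|I hI].
  (* Q is a right inverse of B, so this product is block triangular with identity blocks on the
     diagonal. *)
  suff : \det (col_mx X Q^T *m N) = 1.
    by rewrite det_mulmx => e; apply/eqP => z; move/eqP: e;
      rewrite z mulr0 eq_sym oner_eq0.
  by rewrite mul_col_row XP XB -trmx_mul BQ trmx1 det_lblock !det1 mulr1.
pose T := col_mx X (rowsub (setsel (card_setC_ord hI)) 1%:M).
have TN : \det T * \det N = minor B (~: I)%SET.
  rewrite -det_mulmx mul_col_row XP XB det_lblock det1 mul1r.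
  rewrite -rowsubE (minorE _ (card_setC_ord hI)) -det_tr; congr (\det _).
  by apply/matrixP => i j; rewrite !mxE.
have TX : (-1) ^+ inversions I * \det T = minor X I.
  rewrite -(sign_shuffle hI) -det_col_perm (minorE _ hI).
  have -> : col_perm (shuffle hI) T = block_mx (colsub (setsel hI) X)
      (colsub (setsel (card_setC_ord hI)) X) 0 1%:M.
    apply/matrixP => i j; case: (split_ordP i) => a ->; case: (split_ordP j) => b ->;
      rewrite ?(block_mxEul, block_mxEur, block_mxEdl, block_mxEdr) [LHS]mxE;
      rewrite ?shuffleL ?shuffleR ?col_mxEu ?col_mxEd !mxE //.
      case: eqP => // e; have := setsel_in (card_setC_ord hI) a.
      by rewrite inE e setsel_in.
    by rewrite (inj_eq (@setsel_inj _ _ _ _)).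
  by rewrite det_ublock det1 mulr1.
rewrite /primal_coord -TN mulrA -TX mulrC.
by rewrite mulrCA.
Qed.

End Duality.

(** * Points of the Grassmannian and their coordinates *)

Section Points.
Variable F : fieldType.

Lemma mem_rowspan (m n : nat) (X : 'M[F]_(m, n)) v :
  (v \in rowspan X) = (v <= X)%MS.
Proof.
apply/memv_imgP/submxP => [[u _ ->]|[u ->]]; first by exists u; rewrite lfunE.
by exists u; rewrite ?memvf // lfunE.
Qed.

Lemma rowspan_subE (p m n : nat) (X : 'M[F]_(p, n)) (Y : 'M[F]_(m, n)) :
  (rowspan X <= rowspan Y)%VS = (X <= Y)%MS.
Proof.
apply/subvP/idP => [XY|XY v]; last first.
  by rewrite !mem_rowspan => /submx_trans; apply.
by apply/row_subP => i; rewrite -mem_rowspan XY // mem_rowspan row_sub.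
Qed.

Lemma dim_rowspan (m n : nat) (X : 'M[F]_(m, n)) :
  \dim (rowspan X) = \rank X.
Proof.
have free (p : nat) (Y : 'M[F]_(p, n)) : row_free Y -> \dim (rowspan Y) = p.
  move=> Yf; rewrite limg_dim_eq; first by rewrite dimvf /dim /= mul1n.
  rewrite capfv; apply/eqP/lker0P => u v; rewrite !lfunE /=.
  exact: row_free_inj.
rewrite -(free _ _ (row_base_free X)); congr (\dim _); apply/eqP.
by rewrite eqEsubv !rowspan_subE !eq_row_base submx_refl.
Qed.

Lemma rowspan_Gr_proof (m n : nat) (X : 'M[F]_(m, n)) :
  row_free X -> \dim (rowspan X) == m.
Proof. by rewrite dim_rowspan. Qed.

Definition Gr_of (m n : nat) (X : 'M[F]_(m, n)) (hX : row_free X) : Gr F m n :=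
  exist _ (rowspan X) (rowspan_Gr_proof hX).

Lemma Gr_row_free (m n : nat) (U : Gr F m n) (X : 'M[F]_(m, n)) :
  rowspan X = val U -> row_free X.
Proof. by move=> XU; rewrite /row_free -dim_rowspan XU (eqP (valP U)). Qed.

Lemma Gr_representative (m n : nat) (U : Gr F m n) :
  exists X : 'M[F]_(m, n), rowspan X = val U.
Proof.
pose b := vbasis (val U); have sb : size b = m by rewrite size_tuple (eqP (valP U)).
pose X := \matrix_(i < m) b`_i; exists X; apply/eqP; rewrite eqEsubv.
apply/andP; split; apply/subvP => v.
  rewrite mem_rowspan => /submxP[u ->]; rewrite mulmx_sum_row.
  apply: memv_suml => i _; rewrite rowK; apply/memvZ/vbasis_mem.
  by rewrite mem_nth // sb.
move=> /coord_vbasis ->; apply: memv_suml => i _; apply: memvZ.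
have iX : (i < m)%N by apply: leq_trans (ltn_ord i) _; rewrite (eqP (valP U)).
by rewrite mem_rowspan -[_`_i](rowK (fun j : 'I_m => b`_j) (Ordinal iX)) row_sub.
Qed.

Lemma same_rowspan (m n : nat) (X Y : 'M[F]_(m, n)) : row_free X ->
  rowspan X = rowspan Y -> exists2 Z, Z \in unitmx & X = Z *m Y.
Proof.
move=> Xf /eqP; rewrite eqEsubv !rowspan_subE => /andP[/submxP[Z XZ] _].
exists Z => //; rewrite -row_free_unit -row_leq_rank.
by rewrite -{1}(eqP Xf) XZ mxrankM_maxl.
Qed.

Lemma rowspan_unitM (m n : nat) (Z : 'M[F]_m) (X : 'M[F]_(m, n)) :
  Z \in unitmx -> rowspan (Z *m X) = rowspan X.
Proof.
move=> Zu; apply/eqP; rewrite eqEsubv !rowspan_subE submxMl /=.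
by rewrite -{1}[X](mulKmx Zu) submxMl.
Qed.

Lemma exists_det (l : nat) (c : F) : (0 < l)%N -> exists D : 'M[F]_l, \det D = c.
Proof.
case: l => // l _; exists (diag_mx (\row_i if i == 0 then c else 1)).
rewrite det_diag big_ord_recl mxE eqxx big1 ?mulr1 // => i _.
by rewrite mxE -(inj_eq val_inj).
Qed.

Section Dual.
Variables m l n : nat.
Hypothesis mln : (m + l = n)%N.
Implicit Types (X : 'M[F]_(m, n)) (B : 'M[F]_(l, n)).

Lemma primal_coord_minor X B : row_free X -> row_free B -> B *m X^T = 0 ->
  exists2 c : F, c != 0 &
    forall I : {set 'I_n}, #|I| = m -> primal_coord B I = c * minor X I.
Proof. by move: X B; rewrite -mln; apply: primal_coord_minor_add. Qed.

Lemma primal_coord_mulmx (Y : 'M[F]_l) B (I : {set 'I_n}) : #|I| = m ->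
  primal_coord (Y *m B) I = \det Y * primal_coord B I.
Proof.
move=> hI; rewrite /primal_coord minor_mulmx 1?mulrCA //.
by rewrite cardsCs setCK hI card_ord -mln addKn.
Qed.

Lemma exists_annihilator X : row_free X ->
  exists2 B : 'M[F]_(l, n), row_free B & B *m X^T = 0.
Proof.
move=> Xf; have e : \rank (kermx X^T) = l.
  by rewrite mxrank_ker mxrank_tr (eqP Xf) -mln addKn.
have : row_base (kermx X^T) *m X^T = 0 by apply/sub_kermxP; rewrite eq_row_base.
have := row_base_free (kermx X^T); move: (row_base _); rewrite e => B Bf BX.
by exists B.
Qed.

(** A left factor of determinant [c^-1] absorbs the scalar relating the two systems of
    coordinates. *)
Lemma exists_primal_dual X : (0 < l)%N -> row_free X ->
  exists B : 'M[F]_(l, n), [/\ row_free B, B *m X^T = 0 &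
    forall I : {set 'I_n}, #|I| = m -> primal_coord B I = minor X I].
Proof.
move=> l0 Xf; have [B Bf BX] := exists_annihilator Xf.
have [c c0 E] := primal_coord_minor Xf Bf BX.
have [D dD] := exists_det c^-1 l0.
have Du : D \in unitmx by rewrite unitmxE dD unitfE invr_eq0.
exists (D *m B); split; last 1 first.
- by move=> I hI; rewrite primal_coord_mulmx // dD E // mulKf.
- by rewrite /row_free mxrankMfree // -/(row_free D) row_free_unit.
- by rewrite -mulmxA BX mulmx0.
Qed.

Lemma annihilator_sub (k : nat) (A : 'M[F]_(k, n)) X B :
  row_free X -> row_free B -> B *m X^T = 0 ->
  (A <= X)%MS = (B *m A^T == 0).
Proof.
move=> Xf Bf BX; have XB : X *m B^T = 0 by rewrite -[X]trmxK -trmx_mul BX trmx0.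
have XK : (X == kermx B^T)%MS.
  rewrite -(geq_leqif (mxrank_leqif_eq _)); last exact/sub_kermxP.
  by rewrite mxrank_ker mxrank_tr (eqP Bf) (eqP Xf) -mln addnK.
rewrite (eqmxP XK); apply/sub_kermxP/eqP => AB.
  by rewrite -[B]trmxK -trmx_mul AB trmx0.
by rewrite -[A]trmxK -trmx_mul AB trmx0.
Qed.

Definition annihilates B (U : {vspace 'rV[F]_n}) :=
  forall v, v \in U -> B *m v^T = 0.

Lemma annihilates_rowspan B (k : nat) (A : 'M[F]_(k, n)) :
  annihilates B (rowspan A) <-> B *m A^T = 0.
Proof.
split=> [BA|BA v]; last first.
  rewrite mem_rowspan => /submxP[u ->].
  by rewrite trmx_mul mulmxA BA mul0mx.
apply: trmx_inj; rewrite trmx_mul trmxK trmx0; apply/row_matrixP => i.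
rewrite row_mul row0; apply: trmx_inj; rewrite trmx_mul trmxK trmx0.
by apply: BA; rewrite mem_rowspan row_sub.
Qed.

(** The polynomial f may be non-homogeneous, so proportional coordinates do not suffice: in each
    direction the representative is rescaled until primal and dual coordinates agree exactly. *)
Lemma vanishes_atP (f : plucker_poly F m n) (U : Gr F m n) :
  (0 < l)%N -> (0 < m)%N ->
  vanishes_at f U <-> forall B, row_free B -> annihilates B (val U) ->
    primal_eval f B = 0.
Proof.
move=> l0 m0; have cE (p : 'I_#|ksubsets m n|) : #|enum_val p| = m.
  by have := enum_valP p; rewrite inE => /eqP.
split=> [fU B Bf BU|fU X XU].
  have [X XU] := Gr_representative U; have Xf := Gr_row_free XU.
  move: BU; rewrite -XU => /annihilates_rowspan BX.
  have [c c0 E] := primal_coord_minor Xf Bf BX.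
  have [D dD] := exists_det c m0.
  have Du : D \in unitmx by rewrite unitmxE dD unitfE.
  rewrite -(fU (D *m X)); last by rewrite rowspan_unitM.
  by apply: meval_eq => p; rewrite minor_mulmx // dD E.
have Xf := Gr_row_free XU; have [B [Bf BX E]] := exists_primal_dual l0 Xf.
rewrite -(fU B) //; first by apply: meval_eq => p; rewrite E.
by rewrite -XU; apply/annihilates_rowspan.
Qed.

End Dual.
End Points.

(** * The first fundamental theorem for the special linear group *)

(** Cauchy-Binet before terms are collected: f runs over all maps, and the non-injective ones
    contribute zero determinants. *)
Lemma det_mulmx_ffun (R : comNzRingType) (l n : nat) (X : 'M[R]_(l, n))
    (Y : 'M[R]_(n, l)) :
  \det (X *m Y) =
    \sum_(f : {ffun 'I_l -> 'I_n}) (\prod_i X i (f i)) * \det (rowsub f Y).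
Proof.
transitivity (\sum_(s : 'S_l) \sum_(f : {ffun 'I_l -> 'I_n})
    (-1) ^+ s * \prod_i (X i (f i) * Y (f i) (s i))).
  apply: eq_bigr => s _; rewrite -mulr_sumr; congr (_ * _).
  rewrite -(bigA_distr_bigA (fun i j => X i j * Y j (s i))).
  by apply: eq_bigr => i _; rewrite mxE.
rewrite exchange_big; apply: eq_bigr => f _; rewrite /determinant mulr_sumr.
apply: eq_bigr => s _; rewrite big_split /= mulrCA; congr (_ * (_ * _)).
by apply: eq_bigr => i _; rewrite mxE.
Qed.

(** * The apolar pairing *)

Section Apolar.
Variables (F : numFieldType) (n : nat).
Implicit Types P Q h : {mpoly F[n]}.

(* The apolar (Fischer) pairing: multiplication by a variable is adjoint to
   the derivative with respect to it. *)
Definition apolar P h : F :=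
  \sum_(m <- msupp P) P@_m * (h@_m *+ \prod_i (m i)`!).

Lemma apolarE k P h : (msize P <= k)%N ->
  apolar P h = \sum_(m : 'X_{1..n < k}) P@_m * (h@_m *+ \prod_i (m i)`!).
Proof.
move=> le_Pk; pose I : subFinType _ := 'X_{1..n < k};
  rewrite /apolar (ssrcomplements.big_mksub I) //=; first last.
- by move=> x /msize_mdeg_lt /leq_trans /(_ le_Pk) ->.
- by rewrite msupp_uniq.
by rewrite big_rmcond //= => i /memN_msupp_eq0 ->; rewrite mul0r.
Qed.

Lemma apolarDl P Q h : apolar (P + Q) h = apolar P h + apolar Q h.
Proof.
pose k := maxn (msize (P + Q)) (maxn (msize P) (msize Q)).
rewrite !(@apolarE k) ?leq_max ?leqnn ?orbT // -big_split /=.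
by apply: eq_bigr => m _; rewrite mcoeffD mulrDl.
Qed.

Lemma apolarZl c P h : apolar (c *: P) h = c * apolar P h.
Proof.
pose k := maxn (msize (c *: P)) (msize P).
rewrite !(@apolarE k) ?leq_max ?leqnn ?orbT // mulr_sumr.
by apply: eq_bigr => m _; rewrite mcoeffZ mulrA.
Qed.

Lemma apolar0l h : apolar 0 h = 0.
Proof. by rewrite /apolar msupp0 big_nil. Qed.

Lemma apolar_suml (I : Type) (r : seq I) (f : I -> {mpoly F[n]}) h :
  apolar (\sum_(i <- r) f i) h = \sum_(i <- r) apolar (f i) h.
Proof.
elim: r => [|i r IH]; first by rewrite !big_nil apolar0l.
by rewrite !big_cons apolarDl IH.
Qed.

Lemma apolarDr P h h' : apolar P (h + h') = apolar P h + apolar P h'.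
Proof.
rewrite -big_split; apply: eq_bigr => m _ /=.
by rewrite mcoeffD mulrnDl mulrDr.
Qed.

Lemma apolarZr c P h : apolar P (c *: h) = c * apolar P h.
Proof.
rewrite mulr_sumr; apply: eq_bigr => m _.
by rewrite mcoeffZ -mulrnAr mulrCA.
Qed.

Lemma apolar_sumr (I : Type) (r : seq I) (f : I -> {mpoly F[n]}) P :
  apolar P (\sum_(i <- r) f i) = \sum_(i <- r) apolar P (f i).
Proof.
elim: r => [|i r IH]; last by rewrite !big_cons apolarDr IH.
by rewrite !big_nil /apolar big1 // => m _; rewrite mcoeff0 mul0rn mulr0.
Qed.

Lemma apolarX m h : apolar 'X_[m] h = h@_m *+ \prod_i (m i)`!.
Proof. by rewrite /apolar msuppX big_seq1 mcoeffX eqxx mul1r. Qed.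

Lemma apolarC c h : apolar c%:MP h = c * h@_0.
Proof.
rewrite -[c%:MP]mulr1 mul_mpolyC apolarZl -mpolyX0 apolarX.
by rewrite big1 // => i _; rewrite mnm0E.
Qed.

Lemma apolar_mulX i P h : apolar ('X_i * P) h = apolar P h^`M(i).
Proof.
rewrite [P]mpolyE mulr_sumr !apolar_suml; apply: eq_bigr => m _.
rewrite -scalerAr !apolarZl -mpolyXD !apolarX mcoeff_mderiv addmC -mulrnA.
congr (_ * (_ *+ _)); rewrite (bigD1 i) //= [in RHS](bigD1 i) //= mnmDE mnm1E.
rewrite eqxx addn1 factS mulnA; congr (_ * _)%N.
by apply: eq_bigr => j /negPf ji; rewrite mnmDE mnm1E eq_sym ji addn0.
Qed.

(** The pairing is bilinear, not Hermitian, so positivity holds only for real coefficients, where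
    each term is a square times factorials; X + iY pairs to 0 with itself. *)
Lemma apolar_pos P : P \is a mpolyOver n Num.Def.real_num_pred -> P != 0 -> 0 <
  apolar P P.
Proof.
move=> /mpolyOverP realP nzP; have ge0 m : 0 <= P@_m * (P@_m *+ \prod_i (m i)`!).
  by rewrite mulrnAr mulrn_wge0 // -expr2 real_exprn_even_ge0.
rewrite lt_neqAle sumr_ge0 ?andbT => [|m _]; last exact: ge0.
rewrite eq_sym psumr_eq0 => [|m _]; last exact: ge0.
have mP : mlead P \in msupp P by rewrite mlead_supp.
apply: contraNN nzP => /allP/(_ _ mP); rewrite /= mulrnAr -expr2 mulrn_eq0.
rewrite expf_eq0 mleadc_eq0 /= => /orP[|//]; rewrite -leqn0 leqNgt prodn_gt0 //.
by move=> i; rewrite fact_gt0.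
Qed.

End Apolar.

Lemma mxvec_index_eq (l n : nat) (i i' : 'I_l) (j j' : 'I_n) :
  (mxvec_index i j == mxvec_index i' j') = (i == i') && (j == j').
Proof.
by rewrite /mxvec_index (inj_eq (@cast_ord_inj _ _ _)) (inj_eq enum_rank_inj).
Qed.

(** * Substitutions into generic matrices and the Omega process *)

Section FirstFundamentalTheorem.
Variable F : numFieldType.

Lemma mmap_generic (N l n : nat) (M : 'M[{mpoly F[N]}]_(l, n)) :
  map_mx (mmap (@mpolyC N F) (mxvec M 0)) (generic_matrix F l n) = M.
Proof.
by apply/matrixP => i j; rewrite !mxE mmapX mmap1U mxvecE.
Qed.

Lemma meval_mmap (N l n : nat) (M : 'M[{mpoly F[N]}]_(l, n)) Q v :
  (mmap (@mpolyC N F) (mxvec M 0) Q).@[v] = mxeval Q (map_mx (meval v) M).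
Proof.
rewrite -[_.@[v]]/(meval v _) rmorph_mmap mmap_meval => [|c /=]; last exact: mevalC.
by apply: meval_eq => i; case/mxvec_indexP: i => i j; rewrite /= !mxvecE mxE.
Qed.

Lemma meval_generic (l n : nat) (B : 'M[F]_(l, n)) :
  map_mx (meval (mxvec B 0)) (generic_matrix F l n) = B.
Proof. by apply/matrixP => i j; rewrite !mxE mevalXU mxvecE. Qed.

Lemma map_meval_mpolyC (N a b : nat) v (X : 'M[F]_(a, b)) :
  map_mx (meval v) (map_mx (@mpolyC N F) X) = X.
Proof. by apply/matrixP => i j; rewrite !mxE mevalC. Qed.

Section Substitutions.
Variables (l n : nat) (B : 'M[F]_(l, n)).

(** Q(Y B) as a polynomial in the entries of a generic square matrix Y. *)
Definition left_mul_mpoly : {mpoly F[l * n]} -> {mpoly F[l * l]} :=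
  mmap (@mpolyC _ F)
    (mxvec (generic_matrix F l l *m map_mx (@mpolyC _ F) B) 0).

(** P(Z B^T) as a polynomial in the entries of a generic l x n matrix Z; the adjoint of the previous
    substitution. *)
Definition right_mul_mpoly : {mpoly F[l * l]} -> {mpoly F[l * n]} :=
  mmap (@mpolyC _ F)
    (mxvec (generic_matrix F l n *m map_mx (@mpolyC _ F) B^T) 0).

HB.instance Definition _ := GRing.RMorphism.copy left_mul_mpoly
  (mmap (@mpolyC _ F)
    (mxvec (generic_matrix F l l *m map_mx (@mpolyC _ F) B) 0)).

HB.instance Definition _ := GRing.RMorphism.copy right_mul_mpoly
  (mmap (@mpolyC _ F)
    (mxvec (generic_matrix F l n *m map_mx (@mpolyC _ F) B^T) 0)).

Lemma mderiv_left_mul i s (Q : {mpoly F[l * n]}) :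
  (left_mul_mpoly Q)^`M(mxvec_index i s) =
    \sum_j B s j *: left_mul_mpoly Q^`M(mxvec_index i j).
Proof.
have := mmap_chain_rule (f := @mpolyC _ F)
  (mxvec (generic_matrix F l l *m map_mx (@mpolyC _ F) B) 0)
  (D := @mderiv _ F (mxvec_index i s)) Q (@mderivM _ _ _) (@mderivC _ _ _).
rewrite -/left_mul_mpoly /= => ->.
transitivity (\sum_a \sum_j left_mul_mpoly Q^`M(mxvec_index a j) *
  (mxvec (generic_matrix F l l *m map_mx (@mpolyC _ F) B) 0
    (mxvec_index a j))^`M(mxvec_index i s)).
  by rewrite pair_bigA (reindex _ (curry_mxvec_bij l n)); apply: eq_big => [[]|[]].
have dE a j : (mxvec (generic_matrix F l l *m map_mx (@mpolyC _ F) B) 0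
    (mxvec_index a j))^`M(mxvec_index i s) = ((a == i)%:R * B s j)%:MP.
  rewrite mxvecE mxE raddf_sum (bigD1 s) //= big1 => [|t /negPf ts].
    rewrite addr0 !mxE mulrC mderiv_mulC mderivX mnm1E.
    rewrite mxvec_index_eq eqxx andbT.
    case: eqP => [->|_]; last by rewrite mul0r scale0r mulr0.
    rewrite mul1r scale1r -[X in (X - U_(_))%MM]add0m addmK mpolyX0 mulr1 //.
  rewrite !mxE mulrC mderiv_mulC mderivX mnm1E.
  by rewrite mxvec_index_eq ts andbF scale0r mulr0.
rewrite (bigD1 i) //= [X in _ + X]big1 ?addr0 => [|a /negPf ai].
  by apply: eq_bigr => j _; rewrite dE eqxx mul1r mulrC mul_mpolyC.
by rewrite big1 // => j _; rewrite dE ai mul0r mpolyC0 mulr0.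
Qed.

Lemma apolar_adjoint (P : {mpoly F[l * l]}) (Q : {mpoly F[l * n]}) :
  apolar P (left_mul_mpoly Q) = apolar (right_mul_mpoly P) Q.
Proof.
pose good P := forall Q, apolar P (left_mul_mpoly Q) = apolar (right_mul_mpoly P) Q.
(* Being good is not visibly multiplicative. The induction therefore shows that multiplication by p
   preserves it, and the case of P itself follows from that of 1, where both sides are the constant
   term of Q. *)
suff H : forall p q, good q -> good (p * q).
  rewrite -[P]mulr1; apply: H => {}Q.
  rewrite rmorph1 -mpolyC1 !apolarC !mul1r.
  rewrite -!meval_at0 meval_mmap; apply: meval_eq => i; case/mxvec_indexP: i => i j.
  rewrite mxvecE !mxE raddf_sum big1 // => s _.
  by rewrite /= mevalM mxE mevalXU mul0r.
elim/mpoly_ring_ind => [c|i|p q IHp IHq|p q IHp IHq] r gr.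
- by move=> {}Q; rewrite rmorphM /= [right_mul_mpoly c%:MP]mmapC !mul_mpolyC
  !apolarZl gr.
- move=> {}Q; case/mxvec_indexP: i => i s; rewrite apolar_mulX mderiv_left_mul.
  rewrite apolar_sumr rmorphM /= [right_mul_mpoly 'X_ _]mmapX mmap1U mxvecE mxE.
  rewrite mulr_suml apolar_suml; apply: eq_bigr => j _.
  rewrite apolarZr gr !mxE -mulrA mulrCA mul_mpolyC apolarZl.
  by rewrite apolar_mulX.
- by move=> {}Q; rewrite mulrDl rmorphD /= !apolarDl (IHp _ gr) (IHq _ gr).
- by rewrite -mulrA; apply/IHp/IHq.
Qed.

Lemma right_mul_det :
  right_mul_mpoly (\det (generic_matrix F l l)) =
  \sum_(f : {ffun 'I_l -> 'I_n})
    \det (colsub f B) *: \prod_i 'X_(mxvec_index i (f i)).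
Proof.
rewrite -det_map_mx mmap_generic det_mulmx_ffun; apply: eq_bigr => f _.
rewrite mulrC -mul_mpolyC; congr (_ * _); last by apply: eq_bigr => i _; rewrite mxE.
rewrite -det_map_mx -det_tr; congr (\det _).
by apply/matrixP => i j; rewrite !mxE.
Qed.

End Substitutions.

Lemma apolar_prodX (N : nat) (s : seq 'I_N) (P h : {mpoly F[N]}) :
  apolar (\prod_(i <- s) 'X_i * P) h = apolar P (foldl (fun q i => q^`M(i)) h s).
Proof.
elim: s h => [|i s IH] h; first by rewrite big_nil mul1r.
by rewrite big_cons -mulrA apolar_mulX IH.
Qed.

Lemma det_generic_neq0 (l : nat) : \det (generic_matrix F l l) != 0.
Proof.
apply: contra_eq_neq (det1 F l) => /eqP d0; rewrite -(meval_generic 1%:M).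
by rewrite det_map_mx /= (eqP d0) meval0 eq_sym oner_eq0.
Qed.

(* Cayley's Omega process, in dual form: pair the polynomial [Q (Y B)] of Y
   with [det Y ^ d].  By semi-invariance the result is a non-zero multiple of
   [Q B]; moving the substitution to the other side of the pairing and
   expanding [det (B' B^T)] by Cauchy-Binet, it is a polynomial in the maximal
   minors of B. *)
Lemma first_fundamental_theorem (l m n d : nat) (Q : 'M[F]_(l, n) -> F) :
  (m + l = n)%N -> polyfun Q ->
  (forall (Y : 'M_l) B, Q (Y *m B) = \det Y ^+ d * Q B) ->
  exists q : plucker_poly F m n, forall B, Q B = primal_eval q B.
Proof.
move=> mln [P PE] QY; pose D := \det (generic_matrix F l l).
have left_mulE B : left_mul_mpoly B P = Q B *: D ^+ d.
  apply: mpoly_eq_of_meval => v; pose Y := vec_mx (\row_i v i).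
  have genY : map_mx (meval v) (generic_matrix F l l) = Y.
    by apply/matrixP => i j; rewrite !mxE mevalXU.
  rewrite meval_mmap map_mxM genY map_meval_mpolyC.
  rewrite -PE QY mevalZ -[_.@[v]]/(meval v _) rmorphXn /= mulrC.
  by rewrite -det_map_mx genY.
(* The constant to divide by; it is non-zero since a generic determinant has real coefficients. *)
have cpos : apolar (D ^+ d) (D ^+ d) != 0.
  apply/lt0r_neq0/apolar_pos; last by rewrite expf_neq0 // det_generic_neq0.
  apply: rpredX; apply: rpred_sum => s _; apply: rpredM.
    by apply: rpredX; rewrite rpredN rpred1.
  by apply: rpred_prod => i _; rewrite mxE mpolyOverX.
(* Peel off one factor: [right_mul_det] makes it a sum of maximal minors of B times products of
   variables, and these products move to h as derivatives, giving [dh f]. *)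
have polyM (e : nat) (h : {mpoly F[l * n]}) : exists q : plucker_poly F m n,
    forall B, apolar (right_mul_mpoly B D ^+ e) h = primal_eval q B.
  elim: e h => [|e IH] h.
    exists (h@_0)%:MP => B.
    by rewrite expr0 -mpolyC1 apolarC mul1r /primal_eval mevalC.
  pose dh (f : {ffun 'I_l -> 'I_n}) := foldl (fun q i => q^`M(i)) h
    [seq mxvec_index i (f i) | i <- index_enum 'I_l].
  have [q qE] := fin_all_exists (fun f => IH (dh f)).
  have [p pE] := fin_all_exists (fun f :
    {ffun 'I_l -> 'I_n} => primal_poly_colsub F f mln).
  exists (\sum_f p f * q f) => B.
  rewrite exprS {1}right_mul_det mulr_suml apolar_suml /primal_eval [RHS]raddf_sum.
  apply: eq_bigr => f _; rewrite -scalerAl apolarZl /= mevalM -!/(primal_eval _ _).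
  rewrite pE -qE; congr (_ * _); rewrite -apolar_prodX big_map //.
have [q qE] := polyM d P; exists ((apolar (D ^+ d) (D ^+ d))^-1 *: q) => B.
rewrite /primal_eval mevalZ -/(primal_eval _ _) -qE -rmorphXn /= -apolar_adjoint.
by rewrite left_mulE apolarZr mulrCA mulVf // mulr1.
Qed.

End FirstFundamentalTheorem.

(** * The closure of a generic torus orbit *)

Definition replace_col (R : Type) (m n : nat) (M : 'M[R]_(m, n)) (j : 'I_n)
    (v : 'cV[R]_m) : 'M[R]_(m, n) :=
  \matrix_(a, b) if b == j then v a 0 else M a b.

Lemma det_replace_col (R : comNzRingType) (n : nat) (M : 'M[R]_n) (j : 'I_n)
    (v : 'cV[R]_n) : \det (replace_col M j v) = (\adj M *m v) j 0.
Proof.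
rewrite (expand_det_col _ j) mxE; apply: eq_bigr => a _.
rewrite !mxE eqxx mulrC /cofactor; congr (_ * \det _ * _).
by apply/matrixP => b c; rewrite !mxE eq_sym (negPf (neq_lift _ _)).
Qed.

Lemma adj1mx (R : comNzRingType) (n : nat) : \adj (1%:M : 'M[R]_n) = 1%:M.
Proof. by rewrite -[LHS]mul1mx mul_mx_adj det1. Qed.

Definition fun_upd (k n : nat) (f : 'I_k -> 'I_n) (j : 'I_k) (i : 'I_n) :=
  fun a => if a == j then i else f a.

(** Cramer's rule for the identity matrix: when the pivot block is the identity, exchanging one
    pivot column isolates a single entry. *)
Lemma det_colsub_upd (R : comNzRingType) (k n : nat) (f : 'I_k -> 'I_n)
    (X : 'M[R]_(k, n)) j i :
  colsub f X = 1%:M -> \det (colsub (fun_upd f j i) X) = X j i.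
Proof.
move=> X1; have -> : colsub (fun_upd f j i) X = replace_col 1%:M j (col i X).
  apply/matrixP => a b; rewrite -X1 !mxE /fun_upd.
  by case: eqP => // _; rewrite !mxE.
by rewrite det_replace_col adj1mx mul1mx mxE.
Qed.

Lemma fun_upd_inj (k n : nat) (f : 'I_k -> 'I_n) j i :
  injective f -> i \notin codom f -> injective (fun_upd f j i).
Proof.
move=> fI /codomP fi a b; rewrite /fun_upd.
case: eqP => [->|_]; case: eqP => [->|_] // e; last exact: fI.
- by case: fi; exists b.
- by case: fi; exists a.
Qed.

Lemma det_colsub_diag (R : comNzRingType) (k n : nat) (g : 'I_k -> 'I_n)
    (X : 'M[R]_(k, n)) (t : 'rV[R]_n) :
  \det (colsub g (X *m diag_mx t)) = \det (colsub g X) * \prod_a t 0 (g a).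
Proof.
have -> : colsub g (X *m diag_mx t) = colsub g X *m diag_mx (\row_a t 0 (g a)).
  by apply/matrixP => i j; rewrite !mul_mx_diag !mxE.
rewrite det_mulmx det_diag; congr (_ * _).
by apply: eq_bigr => a _; rewrite mxE.
Qed.

Lemma exists_pivot (F : fieldType) (k n : nat) (X : 'M[F]_(k, n)) : row_free X ->
  exists f : 'I_k -> 'I_n, colsub f X \in unitmx.
Proof.
move=> Xf; have XTf : row_full X^T by rewrite /row_full mxrank_tr.
exists (fullrankfun XTf); rewrite -unitmx_tr.
have -> : (colsub (fullrankfun XTf) X)^T = rowsub (fullrankfun XTf) X^T.
  by apply/matrixP => i j; rewrite !mxE.
exact: fullrowsub_unit.
Qed.

Lemma row_free_colsub (F : fieldType) (m n : nat) (f : 'I_m -> 'I_n)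
    (X : 'M[F]_(m, n)) : \det (colsub f X) != 0 -> row_free X.
Proof.
rewrite -unitfE -unitmxE => Xu; apply/row_freeP.
exists (colsub f 1%:M *m invmx (colsub f X)).
by rewrite mulmxA mulmx_colsub mulmx1 mulmxV.
Qed.

Section OrbitClosure.
Variables (F : fieldType) (k n : nat) (A : 'M[F]_(k, n)).
Hypothesis A_generic : forall I : {set 'I_n}, #|I| = k -> minor A I != 0.

Lemma generic_colsub (f : 'I_k -> 'I_n) : injective f -> \det (colsub f A) != 0.
Proof.
move=> fI; have [I [b [hI ->]]] := det_colsub_minor F fI.
by rewrite mulf_neq0 ?signr_eq0 ?A_generic.
Qed.

Lemma generic_row_free : (k <= n)%N -> row_free A.
Proof.
move=> kn; have wI : injective (widen_ord kn) by move=> i j /(congr1 val) /= /val_inj.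
exact: row_free_colsub (generic_colsub wI).
Qed.

(* A pivot set f of X turns X and A into X' and A' with identity blocks; the
   relations p_(I-j+i) p_(I-j'+i') = p_(I-j+i') p_(I-j'+i) between the
   normalized coordinates on the orbit say that the quotients X' / A' outside
   the block form a matrix of rank one. *)
Lemma orbit_closure_kernel (U : Gr F k n) (X : 'M[F]_(k, n)) :
  (0 < k)%N -> torus_orbit_closure A U -> rowspan X = val U ->
  exists2 t : 'rV[F]_n, t != 0 & (A *m diag_mx t <= X)%MS.
Proof.
move=> k0 UA XU; have Xf := Gr_row_free XU.
have [f Xfu] := exists_pivot Xf.
have fI : injective f.
  case: (injectiveP f) => // /(det_colsub_noninj X) z.
  by move: Xfu; rewrite unitmxE z unitr0.
have Afu : colsub f A \in unitmx by rewrite unitmxE unitfE generic_colsub.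
pose A' := invmx (colsub f A) *m A; pose X' := invmx (colsub f X) *m X.
have AE t : A *m diag_mx t = colsub f A *m (A' *m diag_mx t).
  by rewrite !mulmxA mulmxV // mul1mx.
have A'1 : colsub f A' = 1%:M by rewrite -mulmx_colsub mulVmx.
have X'1 : colsub f X' = 1%:M by rewrite -mulmx_colsub mulVmx.
have X'f a b : X' a (f b) = (a == b)%:R.
  by have /matrixP/(_ a b) := X'1; rewrite !mxE.
have A'f a b : A' a (f b) = (a == b)%:R.
  by have /matrixP/(_ a b) := A'1; rewrite !mxE.
have A'n0 j i : i \notin codom f -> A' j i != 0.
  move=> fi; rewrite -(det_colsub_upd j i A'1) -mulmx_colsub det_mulmx.
  rewrite mulf_neq0 ?generic_colsub //; last exact: fun_upd_inj.
  by rewrite det_inv invr_eq0 generic_colsub.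
have rel j j' i i' : X' j i * X' j' i' * (A' j i' * A' j' i) =
    X' j i' * X' j' i * (A' j i * A' j' i').
  have [p pE] : exists p : 'I_k -> 'I_n -> plucker_poly F k n, forall j i Y,
      plucker_eval (p j i) Y = \det (colsub (fun_upd f j i) Y).
    have H a := fin_all_exists (fun b => plucker_poly_colsub F (fun_upd f a b)).
    by have [p pE] := fin_all_exists H; exists p.
  pose r := (A' j i' * A' j' i) *: (p j i * p j' i') -
            (A' j i * A' j' i') *: (p j i' * p j' i).
  have rE Y : plucker_eval r Y =
      (A' j i' * A' j' i) * (plucker_eval (p j i) Y * plucker_eval (p j' i') Y) -
      (A' j i * A' j' i') * (plucker_eval (p j i') Y * plucker_eval (p j' i) Y).
    by rewrite /plucker_eval mevalB !mevalZ !mevalM.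
  (* On the orbit both products in r carry the same monomial in t, and the entries of A' balance the
     rest; so r vanishes on the orbit, hence at U. *)
  have r0 : plucker_eval r X' = 0.
    apply: (UA r); last by rewrite rowspan_unitM ?unitmx_inv.
    move=> V [t t0 Vt] Y YV.
    have [Z _ ->] := same_rowspan (Gr_row_free YV) (etrans YV Vt).
    rewrite AE.
    have pY a b : plucker_eval (p a b) (Z *m (colsub f A *m (A' *m diag_mx t))) =
        \det Z * \det (colsub f A) * (A' a b * (t 0 b * \prod_(c | c != a) t 0 (f c))).
      rewrite pE mulmxA -mulmx_colsub !det_mulmx det_colsub_diag det_colsub_upd //.
      congr (_ * (_ * _)); rewrite (bigD1 a) //= /fun_upd eqxx; congr (_ * _).
      by apply: eq_bigr => c /negPf ->.
    by rewrite rE !pY; ring.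
  move: r0; rewrite rE !pE !(det_colsub_upd _ _ X'1) => /eqP.
  by rewrite subr_eq0 => /eqP e; rewrite mulrC e mulrC.
suff [t t0 tX] : exists2 t : 'rV[F]_n, t != 0 & (A' *m diag_mx t <= X')%MS.
  exists t => //; apply: submx_trans (submxMl (invmx (colsub f X)) X).
  by apply: submx_trans tX; rewrite AE submxMl.
clearbody A' X'.
(* If some row j of X' is zero outside the pivots, that row is a unit vector and t can be the
   indicator of [f j]. Otherwise the rank one structure gives t. *)
have [H|] := boolP [forall j, exists i, (i \notin codom f) && (X' j i != 0)];
  last first.
  rewrite negb_forall => /existsP[j /existsPn H].
  exists (delta_mx 0 (f j)).
    by apply/eqP => /matrixP/(_ 0 (f j)) /eqP; rewrite !mxE !eqxx oner_eq0.
  apply/submxP; exists (delta_mx j j); apply/matrixP => a i.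
  rewrite mul_mx_diag !mxE eqxx (bigD1 j) //= big1 => [|b /negPf bj]; last first.
    by rewrite mxE bj andbF mul0r.
  rewrite !mxE eqxx andbT addr0.
  case: (boolP (i \in codom f)) => [/codomP[b ->]|ni].
    rewrite X'f A'f (inj_eq fI) (eq_sym j b).
    by case: (eqVneq b j) => [->|]; rewrite ?mulr0.
  have /negbTE -> : i != f j by apply: contraNneq ni => ->; apply: codom_f.
  by have := H i; rewrite ni /= negbK => /eqP ->; rewrite !mulr0.
have nz j : exists2 i, i \notin codom f & X' j i != 0.
  by have /existsP[i /andP[]] := forallP H j; exists i.
pose j0 := Ordinal k0; have [i0 fi0 x0] := nz j0.
(* A zero here would, by the relation, force [X' j i * X' j0 i0] to be zero. *)
have xn0 j : X' j i0 != 0.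
  have [i fi xi] := nz j; have := rel j j0 i i0.
  apply: contraPneq => ->; rewrite !mul0r => /eqP.
  by apply/negP; rewrite !mulf_neq0 ?A'n0.
(* The row factors of the rank one matrix of quotients, normalized at [j0]. Outside the pivots X' is
   diag(u) A' diag(t) with t read off row [j0]; at the pivots t must be 1/u to give the same
   identity. *)
pose u j := (X' j i0 * A' j0 i0) / (A' j i0 * X' j0 i0).
have u0 j : u j != 0 by rewrite !mulf_neq0 ?invr_eq0 ?mulf_neq0 ?A'n0.
pose t := \row_i if [pick b | f b == i] is Some b then (u b)^-1
                 else X' j0 i / A' j0 i.
have tf b : t 0 (f b) = (u b)^-1.
  rewrite mxE; case: pickP => [c /eqP/fI -> //|/(_ b)].
  by rewrite eqxx.
exists t.
  apply/eqP => /matrixP/(_ 0 (f j0)) /eqP; rewrite tf mxE invr_eq0.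
  exact/negP.
apply/submxP; exists (diag_mx (\row_a (u a)^-1)); apply/matrixP => a i.
have dE : (\row_a (u a)^-1) 0 a = (u a)^-1 by rewrite mxE.
rewrite mul_mx_diag mul_diag_mx [LHS]mxE [RHS]mxE dE.
case: (boolP (i \in codom f)) => [/codomP[b ->]|ni].
  rewrite tf X'f A'f; case: eqP => [->|_]; by rewrite ?mul1r ?mulr1 ?mul0r ?mulr0.
rewrite [t 0 i]mxE; case: pickP => [b /eqP bi|_]; first by rewrite -bi codom_f in ni.
rewrite /u; have := rel a j0 i i0; have := A'n0 j0 i ni.
have := A'n0 j0 i0 fi0; have := xn0 a.
move=> z1 z2 z3 e; rewrite invf_div mulrA [RHS]mulrAC; apply/eqP.
rewrite eqr_div ?mulf_neq0 //; apply/eqP.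
by transitivity (X' a i0 * X' j0 i * (A' a i * A' j0 i0)); [ring | rewrite -e; ring].
Qed.

End OrbitClosure.

(** * Divisibility by the Segre determinant *)

Lemma polyfun_mul_neq0 (F : numFieldType) (a b : nat) (f g : 'M[F]_(a, b) -> F) :
  polyfun f -> polyfun g -> (exists B, f B != 0) -> (exists B, g B != 0) ->
  exists B, f B * g B != 0.
Proof.
move=> pf pg [B fB] g0; apply: boolp.contrapT => H; case/eqP: fB.
apply: (polyfun_mul_eq0 pf pg) => // X; apply/eqP/negPn/negP => fg.
by apply: H; exists X.
Qed.

Lemma polyfun_prod_neq0 (F : numFieldType) (a b : nat) (I : Type) (r : seq I)
    (f : I -> 'M[F]_(a, b) -> F) :
  (forall i, polyfun (f i)) -> (forall i, exists B, f i B != 0) ->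
  exists B, \prod_(i <- r) f i B != 0.
Proof.
move=> pf nf; elim: r => [|i r IH]; first by exists 0; rewrite big_nil oner_neq0.
have [B] := polyfun_mul_neq0 (pf i) (polyfun_prod r predT pf) (nf i) IH.
by exists B; rewrite big_cons.
Qed.

Section ReplaceCol.
Variables (R : comNzRingType) (m n : nat).
Implicit Types (M : 'M[R]_(m, n)) (v : 'cV[R]_m).

Lemma replace_colE M j v a b :
  replace_col M j v a b = if b == j then v a 0 else M a b.
Proof. by rewrite mxE. Qed.

Lemma replace_col_id M j : replace_col M j (col j M) = M.
Proof. by apply/matrixP => a b; rewrite !mxE; case: eqP => [->|]. Qed.

Lemma replace_colK M j v w : replace_col (replace_col M j v) j w = replace_col M j w.
Proof. by apply/matrixP => a b; rewrite !mxE; case: eqP. Qed.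

Lemma replace_colC M i j v w : i != j ->
  replace_col (replace_col M i v) j w = replace_col (replace_col M j w) i v.
Proof.
move=> ij; apply/matrixP => a b; rewrite !mxE.
by case: (eqVneq b j) => // ->; rewrite eq_sym (negPf ij).
Qed.

Lemma col_replace_col M j v : col j (replace_col M j v) = v.
Proof. by apply/matrixP => a b; rewrite !mxE eqxx ord1. Qed.

Lemma col_replace_col_neq M i j v : i != j ->
  col i (replace_col M j v) = col i M.
Proof. by move=> /negPf ij; apply/matrixP => a b; rewrite !mxE ij. Qed.

End ReplaceCol.

Lemma det_replace_colB (R : comNzRingType) (n : nat) (M : 'M[R]_n) j x y v w :
  \det (replace_col M j (x *: v - y *: w)) =
    x * \det (replace_col M j v) - y * \det (replace_col M j w).
Proof.
by rewrite !det_replace_col mulmxBr -!scalemxAr !mxE.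
Qed.

Lemma det_replace_col_dup (R : comNzRingType) (n : nat) (M : 'M[R]_n) i j v :
  i != j -> \det (replace_col (replace_col M i v) j v) = 0.
Proof.
move=> ij; rewrite -det_tr; apply: (determinant_alternate ij) => a.
by rewrite !mxE !eqxx (negPf ij).
Qed.

(** * The Segre matrix as a Khatri-Rao product *)

Section KhatriRao.

Definition khatri_rao (R : pzSemiRingType) (k l n : nat) (A : 'M[R]_(k, n))
    (B : 'M[R]_(l, n)) : 'M[R]_(k * l, n) :=
  \matrix_(p, i) (A (mxtens_unindex p).1 i * B (mxtens_unindex p).2 i).

Lemma segre_detE (R : comNzRingType) (k l : nat) (A : 'M[R]_(k, k * l))
    (B : 'M[R]_(l, k * l)) : segre_det A B = \det (khatri_rao A B).
Proof.
congr (\det _); apply/matrixP => p i; rewrite !mxE.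
by congr (A _ _ * B _ _).
Qed.

Lemma mxeval_segre_poly (F : numFieldType) (k l : nat) (A : 'M[F]_(k, k * l)) B :
  mxeval (segre_poly A) B = \det (khatri_rao A B).
Proof.
rewrite /mxeval /segre_poly segre_detE -[_.@[_]]/(meval _ _) -det_map_mx.
congr (\det _); apply/matrixP => p i.
by rewrite !mxE rmorphM /= mevalC mevalXU mxvecE.
Qed.

Lemma khatri_rao_replace_col (R : pzSemiRingType) (k l n : nat) (A : 'M[R]_(k, n))
    (B : 'M[R]_(l, n)) j v :
  khatri_rao A (replace_col B j v) =
    replace_col (khatri_rao A B) j (khatri_rao (col j A) v).
Proof.
by apply/matrixP => p i; rewrite !mxE; case: eqP => // ->.
Qed.

Lemma khatri_raoDr (R : comNzRingType) (k l n : nat) (A : 'M[R]_(k, n))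
    (B C : 'M[R]_(l, n)) x :
  khatri_rao A (B + x *: C) = khatri_rao A B + x *: khatri_rao A C.
Proof. by apply/matrixP => p i; rewrite !mxE mulrDr mulrCA. Qed.

Lemma khatri_rao_colB (R : comNzRingType) (k l n : nat) (A : 'M[R]_(k, n))
    (v w : 'M[R]_(l, n)) x y :
  khatri_rao A (x *: v - y *: w) = x *: khatri_rao A v - y *: khatri_rao A w.
Proof. by apply/matrixP => p i; rewrite !mxE mulrBr !(mulrCA (A _ _)). Qed.

(** Both products are the tensor $\sum_i t_i A_i \otimes B_i$, once as a k x l matrix and once as a
    column. *)
Lemma khatri_rao_kernel (R : comNzRingType) (k l n : nat) (A : 'M[R]_(k, n))
    (B : 'M[R]_(l, n)) (t : 'rV[R]_n) :
  A *m diag_mx t *m B^T = 0 <-> khatri_rao A B *m t^T = 0.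
Proof.
have E a s : (A *m diag_mx t *m B^T) a s =
    (khatri_rao A B *m t^T) (mxtens_index (a, s)) 0.
  rewrite !mxE; apply: eq_bigr => i _.
  by rewrite mul_mx_diag !mxE mxtens_indexK /= mulrAC.
split=> H; apply/matrixP => p i; last by rewrite E H !mxE.
by rewrite ord1; case: (mxtens_indexP p) => a s; rewrite -E H !mxE.
Qed.

End KhatriRao.

(** * Zeros of the Segre determinant with a non-zero column derivative *)

Section SegreDivides.
Variables (F : numClosedFieldType) (k l : nat).
Local Notation n := (k * l)%N.
Variable A : 'M[F]_(k, n).
Hypotheses (k2 : (2 <= k)%N) (l2 : (2 <= l)%N).
Hypothesis A_generic : forall I : {set 'I_n}, #|I| = k -> minor A I != 0.

Local Notation seg B := (\det (khatri_rao A B)).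

Definition color_mx (N : nat) (c : 'I_N -> 'I_l) : 'M[F]_(l, N) :=
  \matrix_(s, i) (s == c i)%:R.

(** When every column of B is a basis vector, the Segre matrix splits into one block per colour,
    made of k columns of A. These are distinct by the second hypothesis, so each block is a non-zero
    minor; a column of A may recur in different colours. *)
Lemma det_khatri_rao_color (a : 'I_n -> 'I_n) (c : 'I_n -> 'I_l) :
  (forall d, #|[set i | c i == d]%SET| = k) ->
  (forall i j, c i = c j -> a i = a j -> i = j) ->
  \det (khatri_rao (colsub a A) (color_mx c)) != 0.
Proof.
move=> hc ha; rewrite -det_tr; apply/det0P => -[v nz_v vM0]; case/eqP: nz_v.
apply/rowP => i0; rewrite mxE; pose sel := setsel (hc (c i0)).
have selc j : c (sel j) = c i0 by have := setsel_in (hc (c i0)) j; rewrite inE => /eqP.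
have sel_inj : injective (a \o sel).
  move=> x y /= e; apply: (@setsel_inj _ _ _ (hc (c i0))); apply: ha => //.
  by rewrite -/(sel x) -/(sel y) !selc.
have [j0 ->] : exists j, i0 = sel j by apply: setsel_onto; rewrite inE.
pose w : 'cV[F]_k := \col_j v 0 (sel j).
suff : colsub (a \o sel) A *m w = 0.
  move/(congr1 (mulmx (invmx (colsub (a \o sel) A)))).
  rewrite mulmx0 mulKmx; last by rewrite unitmxE unitfE generic_colsub.
  by move/matrixP/(_ j0 0); rewrite !mxE.
apply/matrixP => q z; rewrite ord1 [RHS]mxE {z}.
have /matrixP/(_ 0 (mxtens_index (q, c i0))) := vM0.
rewrite mxE [RHS]mxE => S0; rewrite -[RHS]S0.
rewrite (bigID (mem [set i | c i == c i0]%SET)) /= [X in _ = _ + X]big1 ?addr0;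
  last first.
  by move=> i; rewrite inE !mxE mxtens_indexK /= eq_sym => /negPf ->; rewrite !mulr0.
rewrite (reindex sel) /=; last first.
  pose inv i := odflt j0 [pick j | sel j == i].
  exists inv => [j _|i]; rewrite /inv.
    by case: pickP => [j' /eqP/setsel_inj //|/(_ j)]; rewrite eqxx.
  move=> /(setsel_onto (hc (c i0))) [j ->].
  by case: pickP => [j' /eqP //|/(_ j)]; rewrite -/(sel j) eqxx.
rewrite [LHS]mxE; apply: eq_big => [j|j _]; first by rewrite setsel_in.
by rewrite !mxE mxtens_indexK /= selc eqxx mulr1 mulrC.
Qed.

Definition block_color (i : 'I_n) : 'I_l := (mxtens_unindex i).2.

Lemma card_block_color d : #|[set i | block_color i == d]%SET| = k.
Proof.
have fI : injective (fun q : 'I_k => mxtens_index (q, d)).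
  by move=> q q' /(can_inj (@mxtens_indexK _ _)) [].
rewrite -[RHS](card_ord k) -(card_imset predT fI); apply: eq_card => i.
rewrite inE; apply/eqP/imsetP => [<-|[q _ ->]].
  by exists (mxtens_unindex i).1 => //;
    rewrite /block_color -surjective_pairing mxtens_unindexK.
by rewrite /block_color mxtens_indexK.
Qed.

Local Notation C0 := (color_mx block_color).

Lemma seg_color_neq0 : seg C0 != 0.
Proof.
have -> : A = colsub id A by apply/matrixP => i j; rewrite mxE.
by apply: det_khatri_rao_color => // d; apply: card_block_color.
Qed.

Lemma exists_coloring (i j : 'I_n) (c : 'I_l) : i != j ->
  exists c' : 'I_n -> 'I_l, [/\ forall d, #|[set h | c' h == d]%SET| = k,
    c' j = c & c' i != c].
Proof.
move=> ij; have k0 : (0 < k)%N by apply: leq_trans k2.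
have [d dc] : exists d : 'I_l, d != c.
  pose o0 := Ordinal (ltnW l2 : (0 < l)%N); pose o1 := Ordinal (l2 : (1 < l)%N).
  by case: (eqVneq o0 c) => [<-|]; [exists o1 | exists o0].
pose x := mxtens_index (Ordinal k0, c); pose y := mxtens_index (Ordinal k0, d).
have xc : block_color x = c by rewrite /block_color mxtens_indexK.
have yd : block_color y = d by rewrite /block_color mxtens_indexK.
have xy : x != y by apply: contraNneq dc => e; rewrite -yd -e xc.
(* Permuting positions keeps the colour classes of size k; p sends j to x, of colour c, and i to y,
   of another colour d. *)
pose p := (tperm j x * tperm (tperm j x i) y)%g.
have px : p j = x.
  rewrite permM tpermL tpermD // 1?eq_sym //.
  by rewrite eq_sym -{2}(tpermL j x) (inj_eq perm_inj).
have py : p i = y by rewrite permM tpermL.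
exists (block_color \o p); split; rewrite /= ?px ?py ?xc ?yd // => e.
rewrite -[RHS](card_block_color e) -(card_preimset _ (@perm_inj _ p)).
by apply: eq_card => h; rewrite !inE.
Qed.

(* The point [hat B] below has [seg (hat B) = 0] identically in B, and Cramer's
   rule gives a kernel vector all of whose entries are generically non-zero. *)
Lemma vanish_at_smooth_point (G : 'M[F]_(l, n) -> F) (i : 'I_n) (c : 'I_l)
    (B0 : 'M[F]_(l, n)) : polyfun G ->
  (forall B (t : 'rV[F]_n), row_free B -> (forall h, t 0 h != 0) ->
     A *m diag_mx t *m B^T = 0 -> G B = 0) ->
  seg B0 = 0 -> seg (replace_col B0 i (delta_mx c 0)) != 0 -> G B0 = 0.
Proof.
move=> pG hG B0z B0n; pose e : 'cV[F]_l := delta_mx c 0.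
(* The derivative of seg when column i moves along e. In [hat B] column i is corrected along e so
   that seg cancels, and [t B] is the adjugate of the Segre matrix applied to w. *)
pose al B := seg (replace_col B i e).
pose hat B := replace_col B i (al B *: col i B - seg B *: e).
pose w := khatri_rao (col i A) e.
pose t B : 'rV_n := \row_j \det (replace_col (khatri_rao A (hat B)) j w).
have pseg (M : 'M[F]_(l, n) -> 'M[F]_(l, n)) :
    (forall a b, polyfun (fun B => M B a b)) -> polyfun (fun B => seg (M B)).
  move=> pM; apply: polyfun_det => p h.
  have := polyfunM (polyfun_cst _ _ (A (mxtens_unindex p).1 h)) (pM (mxtens_unindex
    p).2 h).
  by apply: eq_polyfun => B; rewrite mxE.
have pent a b : polyfun (fun B : 'M[F]_(l, n) => B a b) by apply: polyfun_entry.
have pal : polyfun al.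
  apply: pseg => a b; case: (eqVneq b i) => [->|bi].
    by apply: eq_polyfun (polyfun_cst _ _ (e a 0)) => B; rewrite replace_colE eqxx.
  by apply: eq_polyfun (pent a b) => B; rewrite replace_colE (negPf bi).
have phat a b : polyfun (fun B => hat B a b).
  case: (eqVneq b i) => [->|bi].
    have := polyfunB (polyfunM pal (pent a i))
      (polyfunM (pseg id pent) (polyfun_cst _ _ (e a 0))).
    by apply: eq_polyfun => B; rewrite replace_colE eqxx !mxE.
  by apply: eq_polyfun (pent a b) => B; rewrite replace_colE (negPf bi).
have pt j : polyfun (fun B => t B 0 j).
  have : polyfun (fun B => \det (replace_col (khatri_rao A (hat B)) j w)).
    apply: polyfun_det => p h; case: (eqVneq h j) => [->|hj].
      by apply: eq_polyfun (polyfun_cst _ _ (w p 0)) => B; rewrite replace_colE eqxx.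
    have := polyfunM (polyfun_cst _ _ (A (mxtens_unindex p).1 h)) (phat
      (mxtens_unindex p).2 h).
    by apply: eq_polyfun => B; rewrite [RHS]replace_colE (negPf hj) [RHS]mxE.
  by apply: eq_polyfun => B; rewrite mxE.
have hat0 B : seg (hat B) = 0.
  rewrite khatri_rao_replace_col khatri_rao_colB det_replace_colB.
  rewrite -!khatri_rao_replace_col replace_col_id -/(al B).
  by rewrite mulrC subrr.
have tker B : A *m diag_mx (t B) *m (hat B)^T = 0.
  apply/khatri_rao_kernel; have -> : (t B)^T = \adj (khatri_rao A (hat B)) *m w.
    by apply/matrixP => j z; rewrite ord1 !mxE det_replace_col mxE.
  by rewrite mulmxA mul_mx_adj hat0 mul_scalar_mx scale0r.
have tn j : exists B, t B 0 j != 0.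
  case: (eqVneq i j) => [<-|ij].
    by exists B0; rewrite mxE -khatri_rao_replace_col /hat replace_colK.
  (* Once column j is w, the part of column i along w drops out, so [t B 0 j] factors and each
     factor can be shown non-zero separately. *)
  pose be B := \det (replace_col (khatri_rao A B) j w).
  have tE B : t B 0 j = al B * be B.
    rewrite mxE khatri_rao_replace_col replace_colC // khatri_rao_colB.
    rewrite det_replace_colB det_replace_col_dup 1?eq_sym // mulr0 subr0.
    have -> : khatri_rao (col i A) (col i B) = col i (khatri_rao A B).
      by apply/matrixP => p z; rewrite !mxE.
    by rewrite -(col_replace_col_neq (khatri_rao A B) w ij) replace_col_id.
  have [c' [hc' c'j c'i]] := exists_coloring c ij.
  have [] := polyfun_mul_neq0 pal (_ : polyfun be) _ _.
  - apply: polyfun_det => p h; case: (eqVneq h j) => [->|hj].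
      by apply: eq_polyfun (polyfun_cst _ _ (w p 0)) => B; rewrite replace_colE eqxx.
    have := polyfunM (polyfun_cst _ _ (A (mxtens_unindex p).1 h)) (pent
      (mxtens_unindex p).2 h).
    by apply: eq_polyfun => B; rewrite [RHS]replace_colE (negPf hj) [RHS]mxE.
  - by exists B0.
  (* Column i of A now occurs at positions i and j, so the colouring must separate them: [c' j = c]
     agrees with w while [c' i != c]. *)
  - exists (color_mx c'); rewrite /be.
    pose a h := if h == j then i else h.
    have -> : replace_col (khatri_rao A (color_mx c')) j w =
        khatri_rao (colsub a A) (color_mx c').
      apply/matrixP => p h; rewrite !mxE /a; case: eqP => // ->.
      by rewrite c'j eqxx andbT.
    apply: det_khatri_rao_color => // x y; rewrite /a.
    case: (eqVneq x j) => [->|xj]; case: (eqVneq y j) => [->|yj] // cxy.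
      by move=> iy; case/eqP: c'i; rewrite iy -cxy.
    by move=> xi; case/eqP: c'i; rewrite -xi cxy.
  by move=> B; rewrite -tE; exists B.
(* Columns avoiding i are left alone by [hat]; their minor being non-zero guarantees that [hat B]
   has full rank. *)
have [g [gI gi]] : exists g : 'I_l -> 'I_n, injective g /\ forall s, g s != i.
  have hc : #|(~: [set i])%SET| = n.-1 by rewrite cardsC1 card_ord.
  have lt_ln : (l < n)%N by rewrite ltn_Pmull // ltnW.
  have ln : (l <= n.-1)%N by rewrite -ltnS prednK // (leq_trans _ lt_ln).
  exists (setsel hc \o widen_ord ln); split.
    by apply: inj_comp (@setsel_inj _ _ _ hc) _ => x y /(congr1 val) /= /val_inj.
  by move=> s; have := setsel_in hc (widen_ord ln s); rewrite !inE.
have pg : polyfun (fun B : 'M[F]_(l, n) => \det (colsub g B)).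
  by apply: polyfun_det => a b; apply: eq_polyfun (pent a (g b)) => B; rewrite mxE.
have Ghat B : G (hat B) = 0.
  move: B; apply: (polyfun_mul_eq0 (polyfun_comp pG phat)
    (polyfunM pg (polyfun_prod (index_enum 'I_n) predT pt))).
    move=> B; case: (eqVneq (\det (colsub g B)) 0) => [->|gB].
      by rewrite mul0r mulr0.
    case: (eqVneq (\prod_j t B 0 j) 0) => [->|tB]; first by rewrite !mulr0.
    rewrite (hG _ (t B)) ?mul0r //; last by move/prodf_neq0: tB => tB h; apply: tB.
    apply: (row_free_colsub (f := g)); rewrite (_ : colsub g (hat B) = colsub g B) //.
    by apply/matrixP => x y; rewrite !mxE (negPf (gi y)).
  apply: polyfun_mul_neq0 => //; first exact: polyfun_prod.
    exists (\matrix_(s, h) (h == g s)%:R).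
    rewrite (_ : colsub _ _ = 1%:M) ?det1 ?oner_neq0 //.
    by apply/matrixP => x y; rewrite !mxE (inj_eq gI) eq_sym.
  exact: polyfun_prod_neq0.
(* Since seg is zero at B', [hat] only scales column i by [al B0]; the inverse factor makes [hat B']
   equal to B0. *)
pose B' := replace_col B0 i ((al B0)^-1 *: col i B0).
have al' : al B' = al B0 by rewrite /al replace_colK.
have sB' : seg B' = 0.
  have := congr1 determinant (khatri_rao_replace_col A B0 i ((al B0)^-1 *: col i B0 -
    0 *: e)).
  rewrite khatri_rao_colB det_replace_colB mul0r subr0 -khatri_rao_replace_col.
  by rewrite replace_col_id B0z mulr0 scale0r subr0.
rewrite -[B0](_ : hat B' = _) // /hat al' sB' scale0r subr0 replace_colK.
by rewrite col_replace_col scalerA mulfV // scale1r replace_col_id.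
Qed.

End SegreDivides.

(** * Resultants, characteristic polynomials and derivatives of pencils *)

Lemma map_resultant_rmorphism (R S : nzRingType) (f : {rmorphism R -> S})
    (p q : {poly R}) :
  f (lead_coef p) != 0 -> f (lead_coef q) != 0 ->
  f (resultant p q) = resultant (map_poly f p) (map_poly f q).
Proof.
move=> nz_fp nz_fq; rewrite /resultant /Sylvester_mx !size_map_poly_id0 //.
rewrite -det_map_mx /= map_col_mx; congr (\det (col_mx _ _));
  by apply: map_lin1_mx => v; rewrite map_poly_rV rmorphM /= map_rVpoly.
Qed.

Lemma horner_char_poly (R : comNzRingType) (n : nat) (M : 'M[R]_n) s :
  (char_poly M).[s] = \det (s%:M - M).
Proof.
rewrite /char_poly -horner_evalE -det_map_mx; congr (\det _).
apply/matrixP => i j; rewrite !mxE /= horner_evalE !hornerE.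
by case: eqP; rewrite ?mulr1n ?mulr0n !hornerE.
Qed.

Lemma deriv_prod (R : comNzRingType) (I : eqType) (r : seq I) (f : I -> {poly R}) :
  uniq r -> (\prod_(i <- r) f i)^`() =
    \sum_(i <- r) \prod_(j <- r) (if j == i then (f j)^`() else f j).
Proof.
elim: r => [|i r IH]; first by rewrite !big_nil -polyC1 derivC.
move=> /= /andP[ir ur]; rewrite !big_cons derivM IH //; congr (_ + _).
  rewrite eqxx; congr (_ * _); apply: eq_big_seq => j jr.
  by case: eqP => // ji; rewrite -ji jr in ir.
rewrite mulr_sumr; apply: eq_big_seq => j jr; rewrite big_cons.
by case: eqP => // ij; rewrite ij jr in ir.
Qed.

Lemma deriv_det (R : comNzRingType) (n : nat) (M : 'M[{poly R}]_n) :
  (\det M)^`() = \sum_i \det (replace_col M i (map_mx (@deriv R) (col i M))).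
Proof.
rewrite -det_tr raddf_sum; under [RHS]eq_bigr do rewrite -det_tr.
rewrite [RHS]exchange_big; apply: eq_bigr => s _ /=.
rewrite -mulr_sumr; have -> : (-1) ^+ s = ((-1) ^+ s)%:P :> {poly R}.
  by rewrite rmorphXn rmorphN1.
rewrite deriv_mulC; congr (_ * _).
rewrite deriv_prod ?index_enum_uniq //; apply: eq_bigr => i _; apply: eq_bigr => j _.
by rewrite !mxE; case: eqP => // ->.
Qed.

Lemma deriv_det_pencil (R : comNzRingType) (n : nat) (M N : 'M[R]_n) z :
  (\det (map_mx (@polyC R) M + 'X *: map_mx (@polyC R) N))^`().[z] =
    \sum_i \det (replace_col (M + z *: N) i (col i N)).
Proof.
rewrite deriv_det -horner_evalE raddf_sum; apply: eq_bigr => i _.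
rewrite /= -det_map_mx; congr (\det _); apply/matrixP => a b.
rewrite !mxE /= (fun_if (horner_eval z)) /= derivD derivM derivX !derivC.
by rewrite mulr0 mul1r addr0 add0r !horner_evalE !hornerE mulrC.
Qed.


Section SegreIdeal.
Variables (F : numClosedFieldType) (k l : nat).
Local Notation n := (k * l)%N.
Variable A : 'M[F]_(k, n).
Hypotheses (k2 : (2 <= k)%N) (l2 : (2 <= l)%N).
Hypothesis A_generic : forall I : {set 'I_n}, #|I| = k -> minor A I != 0.

Local Notation seg B := (\det (khatri_rao A B)).
Local Notation C0 := (color_mx F (@block_color k l)).
Local Notation ev V := (map_poly (meval (mxvec V 0))).

Let C0u : khatri_rao A C0 \in unitmx.
Proof. by rewrite unitmxE unitfE seg_color_neq0. Qed.

(* [p (B + s C0)], as a polynomial in s with coefficients polynomials in B. *)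
Definition on_line (p : {mpoly F[l * n]}) : {poly {mpoly F[l * n]}} :=
  mmap (@polyC _ \o @mpolyC (l * n) F)
    (fun i => ('X_i)%:P + ((mxvec C0 0 i)%:MP)%:P * 'X) p.

Lemma horner_on_line p V s : (ev V (on_line p)).[s] = mxeval p (V + s *: C0).
Proof.
rewrite -horner_evalE /on_line !rmorph_mmap mmap_meval => [|c /=]; last first.
  by rewrite map_polyC /= mevalC horner_evalE hornerC.
apply: meval_eq => i /=; rewrite rmorphD rmorphM /= map_polyX !map_polyC /=.
rewrite mevalXU mevalC horner_evalE hornerD hornerC hornerM hornerX hornerC.
rewrite linearD linearZ /= mxE [X in _ = _ + X]mxE mulrC //.
Qed.

(** The sign and the inverse make [char_poly] equal to seg (B + s C0) / seg C0, which is monic in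
    s. *)
Definition pencil_mx : 'M[{mpoly F[l * n]}]_n :=
  - (map_mx (@mpolyC _ F) (invmx (khatri_rao A C0)) *m
     khatri_rao (map_mx (@mpolyC _ F) A) (generic_matrix F l n)).

Definition pencil_poly : {poly {mpoly F[l * n]}} := char_poly pencil_mx.

Lemma ev_pencil_poly V :
  ev V pencil_poly = char_poly (- (invmx (khatri_rao A C0) *m khatri_rao A V)).
Proof.
rewrite /pencil_poly map_char_poly /pencil_mx map_mxN map_mxM map_meval_mpolyC.
have -> // : map_mx (meval (mxvec V 0))
    (khatri_rao (map_mx (@mpolyC _ F) A) (generic_matrix F l n)) = khatri_rao A V.
by apply/matrixP => i j; rewrite !mxE rmorphM /= mevalC mevalXU mxvecE.
Qed.

Lemma horner_pencil_poly V s :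
  seg C0 * (ev V pencil_poly).[s] = seg (V + s *: C0).
Proof.
rewrite ev_pencil_poly horner_char_poly -det_mulmx; congr (\det _).
by rewrite mulmxBr mulmxN mulKVmx // opprK mul_mx_scalar khatri_raoDr addrC.
Qed.

(** At a simple root the left side is non-zero, so seg has a non-zero derivative in some single
    column; the basis vector inserted is column i of C0. *)
Lemma deriv_pencil_poly V z :
  seg C0 * (ev V pencil_poly)^`().[z] =
    \sum_i seg (replace_col (V + z *: C0) i (delta_mx (block_color i) 0)).
Proof.
have E : seg C0 *: ev V pencil_poly = \det (map_mx (@polyC F) (khatri_rao A V) +
    'X *: map_mx (@polyC F) (khatri_rao A C0)).
  apply/eqP; rewrite -subr_eq0; apply/eqP/poly_eq0_of_horner => s _.
  rewrite hornerD hornerN hornerZ horner_pencil_poly khatri_raoDr.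
  rewrite -[X in _ - X]horner_evalE -det_map_mx; apply/eqP; rewrite subr_eq0; apply/eqP.
  congr (\det _); apply/matrixP => a b; rewrite !mxE /= horner_evalE !hornerE //.
rewrite -hornerZ -derivZ E deriv_det_pencil; apply: eq_bigr => i _.
rewrite khatri_rao_replace_col khatri_raoDr; congr (\det (replace_col _ _ _)).
by apply/matrixP => a b; rewrite [b]ord1 !mxE eqxx andbT.
Qed.

Lemma natr_ord_inj : injective (fun i : 'I_n => i%:R : F).
Proof. by move=> i j /eqP; rewrite eqr_nat => /eqP/val_inj. Qed.

Lemma size_pencil_poly : size pencil_poly = n.+1.
Proof. exact: size_char_poly. Qed.

Let n0 : (0 < n)%N. Proof. by rewrite muln_gt0 (ltnW k2) (ltnW l2). Qed.

Lemma coef_deriv_pencil_poly : pencil_poly^`()`_n.-1 = n%:R.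
Proof.
rewrite coef_deriv prednK //; congr (_ *+ _).
by have := monicP (char_poly_monic pencil_mx); rewrite lead_coefE size_char_poly.
Qed.

Lemma size_deriv_pencil_poly : size pencil_poly^`() = n.
Proof.
apply/anti_leq/andP; split.
  by rewrite -ltnS -[X in (_ < X)%N]size_pencil_poly lt_size_deriv // monic_neq0
    ?char_poly_monic.
rewrite -[X in (X <= _)%N](prednK n0) ltnNge; apply/negP => /leq_sizeP/(_ _ (leqnn _)).
rewrite coef_deriv_pencil_poly => /eqP.
by rewrite -mpolyC_nat mpolyC_eq0 pnatr_eq0 -leqn0 leqNgt n0.
Qed.

(* At B = C0 diag(0, 1, 2, ...) the roots of the pencil are 0, -1, -2, ... *)
Lemma resultant_pencil_neq0 : resultant pencil_poly pencil_poly^`() != 0.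
Proof.
pose V := C0 *m diag_mx (\row_i i%:R : 'rV[F]_n).
have m : pencil_poly \is monic by apply: char_poly_monic.
have E : ev V pencil_poly = \prod_(x <- [seq - (nat_of_ord i)%:R | i <- index_enum
  'I_n]) ('X - x%:P).
  rewrite ev_pencil_poly (_ : _ *m _ = diag_mx (\row_i i%:R)); last first.
    rewrite (_ : khatri_rao A V = khatri_rao A C0 *m diag_mx (\row_i i%:R)).
      by rewrite mulKmx.
    by apply/matrixP => a b; rewrite /V !mul_mx_diag !mxE mulrA.
  rewrite char_poly_trig ?big_map.
    by apply: eq_bigr => i _; rewrite !mxE eqxx mulr1n.
  by apply/is_trig_mxP => i j ij; rewrite !mxE -val_eqE (ltn_eqF ij) mulr0n oppr0.
have sep : separable_poly (ev V pencil_poly).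
  rewrite E separable_prod_XsubC map_inj_uniq ?index_enum_uniq // => i j /oppr_inj.
  exact: natr_ord_inj.
apply/eqP => /(congr1 (meval (mxvec V 0))) /=; rewrite meval0; apply/eqP.
rewrite map_resultant_rmorphism /=; last 2 first.
- by rewrite (monicP m) meval1 oner_neq0.
- by rewrite lead_coefE size_deriv_pencil_poly coef_deriv_pencil_poly rmorph_nat
  pnatr_eq0 -lt0n.
rewrite -deriv_map resultant_eq0 -leqNgt.
by move: sep; rewrite separable_poly.unlock coprimep_def => /eqP ->.
Qed.

Lemma segre_poly_dvd (p : {mpoly F[l * n]}) :
  (forall B (t : 'rV[F]_n), row_free B -> (forall h, t 0 h != 0) ->
     A *m diag_mx t *m B^T = 0 -> mxeval p B = 0) ->
  exists q, p = q * segre_poly A.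
Proof.
move=> p0; have m : pencil_poly \is monic by apply: char_poly_monic.
have nz : pencil_poly != 0 by apply: monic_neq0.
pose q := Pdiv.CommonRing.rdivp (on_line p) pencil_poly;
  pose r := Pdiv.CommonRing.rmodp (on_line p) pencil_poly.
have E : on_line p = q * pencil_poly + r by apply: Pdiv.RingMonic.rdivp_eq.
have rs : (size r <= n)%N by rewrite -ltnS -size_pencil_poly Pdiv.CommonRing.ltn_rmodp.
(* At s = 0 the dividend becomes p and the divisor becomes seg up to a scalar. *)
suff r0 : r = 0.
  have seg0 : segre_poly A = seg C0 *: pencil_poly.[0].
    apply: mxeval_eq => V; rewrite mxeval_segre_poly /mxeval mevalZ.
    have -> : pencil_poly.[0].@[mxvec V 0] = (ev V pencil_poly).[0].
      by rewrite -[X in _ = _.[X]](rmorph0 (meval (mxvec V 0))) horner_map.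
    by rewrite horner_pencil_poly scale0r addr0.
  have p0E : p = (on_line p).[0].
    apply: mxeval_eq => V; rewrite [RHS]/mxeval.
    have -> : (on_line p).[0].@[mxvec V 0] = (ev V (on_line p)).[0].
      by rewrite -[X in _ = _.[X]](rmorph0 (meval (mxvec V 0))) horner_map.
    by rewrite horner_on_line scale0r addr0.
  exists ((seg C0)^-1 *: q.[0]); rewrite {1}p0E E r0 addr0 hornerM seg0.
  by rewrite -scalerAl -scalerAr scalerA mulVf ?seg_color_neq0 // scale1r.
have H V : mxeval (resultant pencil_poly pencil_poly^`()) V != 0 -> ev V r = 0.
  move=> resV; have mV : ev V pencil_poly \is monic by apply: monic_map.
  have szV : size (ev V pencil_poly) = n.+1.
    by rewrite ev_pencil_poly size_char_poly.
  (* The resultant lies in the ideal of the polynomial and its derivative. Specialized at V this is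
     a Bezout identity with a non-zero constant, so the n roots are distinct; at each of them p,
     hence the remainder of degree less than n, will vanish. *)
  have [u uE] : exists u, (mxeval (resultant pencil_poly pencil_poly^`()) V)%:P =
      u.1 * ev V pencil_poly + u.2 * (ev V pencil_poly)^`().
    have [||[u v] _ uvE] := @resultant_in_ideal _ pencil_poly pencil_poly^`().
    - by rewrite size_pencil_poly ltnS.
    - by rewrite size_deriv_pencil_poly (leq_trans k2) // leq_pmulr // ltnW.
    exists (ev V u, ev V v); rewrite /= deriv_map -!rmorphM -rmorphD /= -uvE.
    by rewrite map_polyC.
  have noroot z : (ev V pencil_poly).[z] = 0 -> (ev V pencil_poly)^`().[z] != 0.
    move=> rz; apply: contraNneq resV => rz'.
    by have /(congr1 (horner_eval z)) := uE;
      rewrite !horner_evalE hornerC hornerD !hornerM rz rz' !mulr0 addr0 => ->.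
  have [s sE] := closed_field_poly_normal (ev V pencil_poly).
  rewrite (monicP mV) scale1r in sE.
  have us : uniq s.
    rewrite -separable_prod_XsubC -sE separable_poly.unlock.
    apply/Bezout_coprimepP; exists u; rewrite -uE.
    by rewrite -size_poly_eq1 size_polyC resV.
  apply/eqP/negPn/negP => nzr.
  have := max_poly_roots nzr _ us; rewrite ltnNge.
  have -> : (size (ev V r) <= size s)%N.
    apply: leq_trans (size_poly _ _) _; apply: leq_trans rs _.
    by rewrite -ltnS -szV sE size_prod_XsubC.
  move=> C; apply: notF; apply: C; apply/allP => z zs.
  have rz : (ev V pencil_poly).[z] = 0.
    by apply/rootP; rewrite sE root_prod_XsubC.
  have := noroot z rz; rewrite -(mulrI_eq0 _ (lregP (seg_color_neq0 A_generic))).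
  rewrite deriv_pencil_poly => sum0.
  have [i si] : exists i, seg (replace_col (V + z *: C0) i (delta_mx (block_color i)
    0)) != 0.
    apply/existsP; apply: contraNT sum0; rewrite negb_exists => /forallP S.
    by rewrite big1 // => i _; apply/eqP/negPn/S.
  have : mxeval p (V + z *: C0) = 0.
    apply: (vanish_at_smooth_point k2 l2 A_generic _ p0 _ si).
      exact: polyfun_mxeval.
    by rewrite -horner_pencil_poly rz mulr0.
  rewrite -horner_on_line E rmorphD rmorphM /= hornerD hornerM rz mulr0 add0r.
  by move=> /rootP.
apply/polyP => i; rewrite coef0; apply: mxeval_eq => V; rewrite [RHS]/mxeval meval0.
move: V; apply: (polyfun_mul_eq0 (polyfun_mxeval _)
  (polyfun_mxeval (resultant pencil_poly pencil_poly^`()))).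
  move=> V; case: (eqVneq (mxeval (resultant pencil_poly pencil_poly^`()) V) 0).
    by move=> ->; rewrite mulr0.
  move=> /H /polyP/(_ i); rewrite coef_map coef0 /= => rV.
  by rewrite [X in X * _]rV mul0r.
apply: boolp.contrapT => noV; case/eqP: resultant_pencil_neq0.
apply: mxeval_eq => V; rewrite [RHS]/mxeval meval0; apply/eqP/negPn/negP => Vn.
by apply: noV; exists V.
Qed.

End SegreIdeal.

(** * Plucker coordinates of the Segre determinant *)

(** The matrix is block diagonal with k copies of Y; the induction splits off the first one. *)
Lemma det_tens1mx (R : comNzRingType) (k l : nat) (Y : 'M[R]_l) :
  \det ((1%:M : 'M_k) *t Y) = \det Y ^+ k.
Proof.
elim: k => [|k IH]; first by rewrite expr0 det_mx00.
have iL (a : 'I_l) : lshift (k * l) a = mxtens_index (ord0 : 'I_k.+1, a).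
  by apply: val_inj.
have iR (q : 'I_k) (s : 'I_l) :
    rshift l (mxtens_index (q, s)) = mxtens_index (lift ord0 q, s).
  by apply: val_inj; rewrite /= /bump /= add1n mulSn addnA.
rewrite exprS -IH -[RHS](det_ublock Y 0); congr (\det _).
apply/matrixP => i j; case: (split_ordP i) => a ->; case: (split_ordP j) => b ->.
- by rewrite [RHS]block_mxEul !iL tensmxE !mxE eqxx mul1r.
- rewrite [RHS]block_mxEur; case: (mxtens_indexP b) => {}b b'.
  by rewrite iL iR tensmxE !mxE mul0r.
- rewrite [RHS]block_mxEdl; case: (mxtens_indexP a) => {}a a'.
  by rewrite iL iR tensmxE !mxE mul0r.
- rewrite [RHS]block_mxEdr; case: (mxtens_indexP a) => {}a a'.
  case: (mxtens_indexP b) => {}b b'; rewrite !iR !tensmxE !mxE.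
  by rewrite (inj_eq lift_inj).
Qed.

Lemma khatri_rao_mulmx (R : comNzRingType) (k l n : nat) (A : 'M[R]_(k, n))
    (Y : 'M[R]_l) (B : 'M[R]_(l, n)) :
  khatri_rao A (Y *m B) = (1%:M *t Y) *m khatri_rao A B.
Proof.
apply/matrixP => p i; case: (mxtens_indexP p) => a s.
rewrite !mxE mxtens_indexK /= mulr_sumr.
have bij : {on predT, bijective (@mxtens_index k l)}.
  exists (@mxtens_unindex k l) => x _; [exact: mxtens_indexK | exact: mxtens_unindexK].
transitivity (\sum_b \sum_r (1%:M *t Y) (mxtens_index (a, s)) (mxtens_index (b, r)) *
  khatri_rao A B (mxtens_index (b, r)) i); last first.
  by rewrite pair_bigA [RHS](reindex _ bij); apply: eq_bigr => -[].
rewrite (bigD1 a) //= [X in _ + X]big1 => [|b /negPf ba].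
  rewrite addr0; apply: eq_bigr => r _.
  by rewrite tensmxE !mxE mxtens_indexK eqxx mul1r mulrCA.
by rewrite big1 // => r _; rewrite tensmxE !mxE eq_sym ba !mul0r.
Qed.

Lemma meval_dhomog (R : comNzRingType) (N e : nat) (p : {mpoly R[N]}) (x :
  'I_N -> R) s :
  p \is e.-homog -> p.@[fun i => s * x i] = s ^+ e * p.@[x].
Proof.
move=> /dhomogP hp; rewrite !mevalE mulr_sumr; apply: eq_big_seq => m /hp em.
have {em} -> : e = mdeg m by rewrite -em.
rewrite mulrCA; congr (_ * _); rewrite mdegE expr_sum -big_split.
by apply: eq_bigr => i _; rewrite exprMn.
Qed.

Section PrimalCoordinates.
Variables (F : numFieldType) (m l n : nat).
Hypotheses (mln : (m + l = n)%N) (l0 : (0 < l)%N) (m0 : (0 < m)%N).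
Implicit Types f g : plucker_poly F m n.

Lemma card_ksubset (p : 'I_#|ksubsets m n|) : #|enum_val p| = m.
Proof. by have := enum_valP p; rewrite inE => /eqP. Qed.

Lemma mxeval_in_primal_coords f (B : 'M[F]_(l, n)) :
  mxeval (in_primal_coords l f) B = primal_eval f B.
Proof.
rewrite /mxeval comp_mpoly_meval; apply: meval_eq => p; rewrite tnth_mktuple.
have hI : #|(~: enum_val p)%SET| = l.
  by rewrite cardsCs setCK card_ksubset card_ord -mln addKn.
rewrite /primal_coord !(minorE _ hI) -[_.@[_]]/(meval _ _) rmorphM rmorphXn rmorphN1 /=.
congr (_ * _); rewrite -det_map_mx; congr (\det _).
by apply/matrixP => i j; rewrite !mxE /= mevalXU mxvecE.
Qed.

Lemma polyfun_primal_eval f : polyfun (@primal_eval F l m n f).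
Proof. by exists (in_primal_coords l f) => B; rewrite mxeval_in_primal_coords. Qed.

Lemma primal_evalM f g (B : 'M[F]_(l, n)) :
  primal_eval (f * g) B = primal_eval f B * primal_eval g B.
Proof. exact: mevalM. Qed.

Lemma primal_eval_mulmx f (Y : 'M[F]_l) (B : 'M[F]_(l, n)) :
  primal_eval f (Y *m B) = f.@[fun p => \det Y * primal_coord B (enum_val p)].
Proof.
by apply: meval_eq => p; rewrite (primal_coord_mulmx mln) // card_ksubset.
Qed.

Lemma exists_Gr_annihilated (B : 'M[F]_(l, n)) : row_free B ->
  exists X : 'M[F]_(m, n), row_free X /\ B *m X^T = 0.
Proof.
move=> Bf; have lmn : (l + m = n)%N by rewrite addnC.
have [X Xf XB] := exists_annihilator lmn Bf.
by exists X; split=> //; rewrite -[B]trmxK -trmx_mul XB trmx0.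
Qed.

(** Points of the Grassmannian see only matrices B of full rank, but these are dense; so the
    coordinate ring embeds into the polynomials in the entries of B. *)
Lemma vanishing_setTP f : vanishing_ideal [set: Gr F m n]%classic f <->
  in_primal_coords l f = 0.
Proof.
split=> [f0|f0 U _]; last first.
  apply/(vanishes_atP mln _ _ l0 m0) => B _ _.
  by rewrite -mxeval_in_primal_coords f0 /mxeval meval0.
apply: mxeval_eq => B; rewrite [RHS]/mxeval meval0.
have ln : (l <= n)%N by rewrite -mln leq_addl.
pose g := widen_ord ln.
have gI : injective g by move=> x y /(congr1 val) /= /val_inj.
move: B; apply: (polyfun_mul_eq0 (polyfun_mxeval _)
    (_ : polyfun (fun B : 'M[F]_(l, n) => \det (colsub g B)))).
- apply: polyfun_det => a b; apply: eq_polyfun (polyfun_entry _ a (g b)) => B.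
  by rewrite mxE.
- move=> B; case: (eqVneq (\det (colsub g B)) 0) => [->|gB]; first by rewrite mulr0.
  have Bf := row_free_colsub gB; have [X [Xf BX]] := exists_Gr_annihilated Bf.
  rewrite mxeval_in_primal_coords.
  have /(vanishes_atP mln _ _ l0 m0)/(_ B Bf) -> := f0 (Gr_of Xf) I; rewrite ?mul0r //.
  exact/annihilates_rowspan.
exists (\matrix_(s, h) (h == g s)%:R).
rewrite (_ : colsub _ _ = 1%:M) ?det1 ?oner_neq0 //.
by apply/matrixP => x y; rewrite !mxE (inj_eq gI) eq_sym.
Qed.

Lemma in_primal_coordsB f g :
  in_primal_coords l (f - g) = in_primal_coords l f - in_primal_coords l g.
Proof. exact: comp_mpolyB. Qed.

Lemma in_primal_coordsM f g :
  in_primal_coords l (f * g) = in_primal_coords l f * in_primal_coords l g.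
Proof. exact: rmorphM. Qed.

Lemma coord_eqP f g : coord_eq f g <-> in_primal_coords l f = in_primal_coords l g.
Proof.
rewrite /coord_eq vanishing_setTP in_primal_coordsB.
by split=> [/eqP|->]; rewrite ?subrr // subr_eq0 => /eqP.
Qed.

End PrimalCoordinates.

(** * Irreducible closed sets and prime ideals *)

Section Zariski.
Variables (F : numFieldType) (m n : nat).
Hypothesis m0 : (0 < m)%N.
Implicit Types (f g : plucker_poly F m n) (S W : set (Gr F m n)).

(* Rescaling the coordinates at U makes f and g polynomials in the scalar. *)
Lemma vanishes_atM f g (U : Gr F m n) :
  vanishes_at (f * g) U -> vanishes_at f U \/ vanishes_at g U.
Proof.
move=> fgU; have [X XU] := Gr_representative U.
pose h f : {poly F} := mmap polyC (fun p => (minor X (enum_val p))%:P * 'X) f.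
have hE f' Z : plucker_eval f' (Z *m X) = (h f').[\det Z].
  rewrite -horner_evalE /h rmorph_mmap mmap_meval => [|c /=]; last first.
    by rewrite horner_evalE hornerC.
  apply: meval_eq => p; rewrite /= horner_evalE hornerM hornerC hornerX mulrC.
  by rewrite minor_mulmx // card_ksubset.
have van f' : h f' = 0 -> vanishes_at f' U.
  move=> hf Y YU; have [Z _ ->] := same_rowspan (Gr_row_free YU) (etrans YU (esym XU)).
  by rewrite hE hf horner0.
have /eqP : h f * h g = 0.
  apply: poly_eq0_of_horner => s s0; have [Z dZ] := exists_det s m0.
  rewrite hornerM -dZ -!hE -mevalM -/(plucker_eval _ _); apply: fgU.
  by rewrite rowspan_unitM // unitmxE unitfE dZ.
by rewrite mulf_eq0 => /orP[] /eqP/van; [left | right].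
Qed.

Lemma vanishing_zclosure S f :
  vanishing_ideal (zclosure S) f <-> vanishing_ideal S f.
Proof.
split=> [H U SU|H U UZ]; last exact: UZ.
by apply: H => g; apply.
Qed.

Lemma zclosure_closed S : zclosed (zclosure S).
Proof.
by apply/boolp.funext => U; apply/boolp.propext; split=> H f Hf; apply: H;
  apply/vanishing_zclosure.
Qed.

Lemma zclosed_vanishing f : zclosed [set U : Gr F m n | vanishes_at f U]%classic.
Proof.
apply/boolp.funext => U; apply/boolp.propext; split=> [H|fU g]; first by apply: H.
by apply.
Qed.

Lemma irreducible_prime W f g : irreducible_closed W ->
  vanishing_ideal W (f * g) -> vanishing_ideal W f \/ vanishing_ideal W g.
Proof.
move=> [_ _ irr] fgW; apply: (irr _ _ (zclosed_vanishing f) (zclosed_vanishing g)).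
by move=> U /fgW /vanishes_atM.
Qed.

(** If W lies in neither closed set, choose for each a polynomial vanishing on it but not on W; the
    product vanishes on W, against primality. *)
Lemma prime_irreducible W : zclosed W -> (W !=set0)%classic ->
  (forall f g, vanishing_ideal W (f * g) ->
    vanishing_ideal W f \/ vanishing_ideal W g) -> irreducible_closed W.
Proof.
move=> cW nW pr; split=> // Z1 Z2 c1 c2 WZ;
  apply: boolp.contrapT => /boolp.not_orP[n1 n2].
have sep Z : zclosed Z -> ~ (W `<=` Z)%classic ->
    exists2 f, vanishing_ideal Z f & ~ vanishing_ideal W f.
  move=> cZ nZ; apply: boolp.contrapT => H; apply: nZ => U WU; rewrite -cZ => f fZ.
  by apply: boolp.contrapT => fU; apply: H; exists f => // fW; apply/fU/fW.
have [f f1 fW] := sep _ c1 n1; have [g g2 gW] := sep _ c2 n2.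
case: (pr f g) => // U /WZ[/f1|/g2] H X /H.
  by rewrite /plucker_eval mevalM => ->; rewrite mul0r.
by rewrite /plucker_eval mevalM => ->; rewrite mulr0.
Qed.

End Zariski.

(** * The Chow-Lam form of a generic torus orbit *)

Lemma leq_add_mul (a b : nat) : (2 <= a)%N -> (2 <= b)%N -> (a + b <= a * b)%N.
Proof.
move=> a2; case: b => // b b0; rewrite mulnS leq_add2l.
apply: leq_trans (leq_mul a2 (leqnn b)).
by rewrite mul2n -addnn -[b.+1]addn1 leq_add2l.
Qed.

Lemma det_mx0 (R : comNzRingType) (N : nat) : (0 < N)%N -> \det (0 : 'M[R]_N) = 0.
Proof. by case: N => // N _; rewrite det0. Qed.

Lemma coord_eq_vanishing (F : fieldType) (m n : nat) (f g : plucker_poly F m n)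
    (W : set (Gr F m n)) :
  coord_eq f g -> vanishing_ideal W g -> vanishing_ideal W f.
Proof.
move=> fg gW U UW X XU; have := fg U I X XU; rewrite /plucker_eval mevalB.
by rewrite [X in _ - X](gW U UW X XU) subr0.
Qed.

Lemma coord_eq_sym (F : fieldType) (m n : nat) (f g : plucker_poly F m n) :
  coord_eq f g -> coord_eq g f.
Proof.
move=> fg U UT X XU; have := fg U UT X XU.
by rewrite /plucker_eval !mevalB => /eqP; rewrite subr_eq0 eq_sym -subr_eq0 => /eqP.
Qed.

Lemma vanishing_ideal_mull (F : fieldType) (m n : nat) (f g : plucker_poly F m n)
    (W : set (Gr F m n)) :
  vanishing_ideal W g -> vanishing_ideal W (f * g).
Proof.
move=> gW U UW X XU; rewrite /plucker_eval mevalM.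
by rewrite [X in _ * X](gW U UW X XU) mulr0.
Qed.

Section ChowLam.
Variables (F : numClosedFieldType) (k l m : nat).
Local Notation n := (k * l)%N.
Variable A : 'M[F]_(k, n).
Hypotheses (k2 : (2 <= k)%N) (l2 : (2 <= l)%N) (mln : (m + l = n)%N).
Hypothesis A_generic : forall I : {set 'I_n}, #|I| = k -> minor A I != 0.
Implicit Types f g q : plucker_poly F m n.

Local Notation seg B := (\det (khatri_rao A B)).

Let k0 : (0 < k)%N. Proof. exact: ltnW. Qed.
Let l0 : (0 < l)%N. Proof. exact: ltnW. Qed.
Let m0 : (0 < m)%N.
Proof. by rewrite -(ltn_add2r l) mln add0n ltn_Pmull. Qed.

Let locus : set (Gr F m n) :=
  [set W : Gr F m n |
    exists2 U : Gr F k n, torus_orbit_closure A U & (val U <= val W)%VS]%classic.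

(** Tests only those ker B that contain a point of the orbit itself, with no limit points;
    [locus_idealP] shows that this still cuts out the ideal of the locus. *)
Definition vanishes_on_orbit f := forall (B : 'M[F]_(l, n)) (t : 'rV[F]_n),
  row_free B -> (forall h, t 0 h != 0) -> A *m diag_mx t *m B^T = 0 ->
  primal_eval f B = 0.

Lemma polyfun_seg : polyfun (fun B : 'M[F]_(l, n) => seg B).
Proof. by exists (segre_poly A) => B; rewrite mxeval_segre_poly. Qed.

Lemma seg_mulmx (Y : 'M[F]_l) (B : 'M[F]_(l, n)) :
  seg (Y *m B) = \det Y ^+ k * seg B.
Proof. by rewrite khatri_rao_mulmx det_mulmx det_tens1mx. Qed.

Lemma exists_segre_plucker : exists f, in_primal_coords l f = segre_poly A.
Proof.
have [f fE] := first_fundamental_theorem mln polyfun_seg seg_mulmx.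
exists f; apply: mxeval_eq => B.
by rewrite mxeval_in_primal_coords // -fE mxeval_segre_poly.
Qed.

Lemma vanishes_on_orbit_locus f : vanishing_ideal locus f -> vanishes_on_orbit f.
Proof.
move=> fL B t Bf t0 AtB; pose X1 := A *m diag_mx t.
have tu : diag_mx t \in unitmx.
  by rewrite unitmxE det_diag unitfE; apply/prodf_neq0.
have X1f : row_free X1.
  rewrite /row_free mxrankMfree ?row_free_unit // -/(row_free A).
  by apply: generic_row_free => //; rewrite leq_pmulr.
have [X [Xf BX]] := exists_Gr_annihilated mln Bf.
have : vanishes_at f (Gr_of Xf).
  apply: fL; exists (Gr_of X1f).
    by move=> g gA; apply: gA; exists t.
  rewrite rowspan_subE (annihilator_sub mln _ Xf Bf BX).
  by rewrite -[B]trmxK -trmx_mul AtB trmx0.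
move/(vanishes_atP mln _ _ l0 m0); apply => //.
exact/annihilates_rowspan.
Qed.

Lemma segre_vanishes_locus f0 : in_primal_coords l f0 = segre_poly A ->
  vanishing_ideal locus f0.
Proof.
move=> f0E W [U UA UW]; apply/(vanishes_atP mln _ _ l0 m0) => B Bf BW.
rewrite -mxeval_in_primal_coords // f0E mxeval_segre_poly.
have [X XU] := Gr_representative U.
have [t t0 tX] := orbit_closure_kernel A_generic k0 UA XU.
have BX : B *m X^T = 0.
  apply/annihilates_rowspan => v; rewrite XU => vU.
  by apply: BW; apply: subvP vU.
have /khatri_rao_kernel : A *m diag_mx t *m B^T = 0.
  case/submxP: tX => Z ->; rewrite -mulmxA.
  by rewrite -[X]trmxK -trmx_mul BX trmx0 mulmx0.
move=> ker; apply/eqP; rewrite -det_tr; apply/det0P; exists t => //.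
by rewrite -[t]trmxK -trmx_mul ker trmx0.
Qed.

(** Replacing B by Y B with det Y = s keeps the conditions on B and scales all coordinates by s; the
    homogeneous components are the coefficients of the resulting polynomial in s. *)
Lemma vanishes_on_orbit_pihomog f e :
  vanishes_on_orbit f -> vanishes_on_orbit (pihomog mdeg e f).
Proof.
move=> fO B t Bf t0 AtB; pose p (i : 'I_#|ksubsets m n|) := primal_coord B (enum_val i).
have fE : f = \sum_(d < msize f) pihomog mdeg d f by apply: pihomog_partitionE.
have [lt_e|ge_e] := ltnP e (msize f); last first.
  rewrite /primal_eval (_ : pihomog _ _ _ = 0) ?meval0 // pihomogE big_seq_cond.
  apply: big_pred0 => u; apply/negP => /andP[/msize_mdeg_lt uf /eqP ue].
  by move: uf; rewrite ue ltnNge ge_e.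
pose h : {poly F} := \poly_(d < msize f) (pihomog mdeg d f).@[p].
suff h0 : h = 0 by rewrite /primal_eval -/p;
  have := coef_poly (msize f) (fun d => (pihomog mdeg d f).@[p]) e;
    rewrite -/h h0 coef0 lt_e.
apply: poly_eq0_of_horner => s s0; have [Y dY] := exists_det s l0.
have Yu : Y \in unitmx by rewrite unitmxE unitfE dY.
have := fO (Y *m B) t _ t0 _; rewrite (primal_eval_mulmx mln) dY.
have -> : f.@[fun i => s * p i] = h.[s].
  rewrite {1}fE raddf_sum horner_poly; apply: eq_bigr => d _ /=.
  by rewrite (meval_dhomog _ _ (pihomogP _ d f)) mulrC.
apply.
- by rewrite /row_free mxrankMfree // -/(row_free Y) row_free_unit.
- by rewrite trmx_mul mulmxA AtB mul0mx.
Qed.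

Lemma polyfun_row_mx (a b c : nat) (g : 'M[F]_(a, c) -> F) :
  polyfun g -> polyfun (fun Z : 'M[F]_(a, b + c) => g (rsubmx Z)).
Proof.
move=> pg; apply: polyfun_comp pg _ => i j.
by apply: eq_polyfun (polyfun_entry _ i (rshift b j)) => Z; rewrite mxE.
Qed.

(** Comparing f (Y B) with seg (Y B) and cancelling seg gives det Y ^ k * Q (Y B) = det Y ^ e * Q B.
    If k <= e, then Q has weight e - k and the first fundamental theorem applies; otherwise Y = 0
    forces Q = 0. *)
Lemma semi_invariant_quotient (e : nat) (Q : {mpoly F[l * n]}) f :
  f \is e.-homog -> in_primal_coords l f = Q * segre_poly A ->
  exists q, in_primal_coords l q = Q.
Proof.
move=> fh fQ; pose QE := mxeval Q.
(* A pair (Y, B) is stored as the single matrix [row_mx Y B], so that polynomial identities in both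
   can be tested by density. *)
have pdet (c : nat) : polyfun (fun Z : 'M[F]_(l, l + c) => \det (lsubmx Z)).
  apply: polyfun_det => i j; apply: eq_polyfun (polyfun_entry _ i (lshift c j)) => Z.
  by rewrite mxE.
have pQ : polyfun (fun Z : 'M[F]_(l, l + n) => QE (rsubmx Z)).
  exact/polyfun_row_mx/polyfun_mxeval.
have pQY : polyfun (fun Z : 'M[F]_(l, l + n) => QE (lsubmx Z *m rsubmx Z)).
  apply: polyfun_comp (polyfun_mxeval Q) _; apply: polyfun_mulmx => i j.
    by apply: eq_polyfun (polyfun_entry _ i (lshift n j)) => Z; rewrite mxE.
  by apply: eq_polyfun (polyfun_entry _ i (rshift l j)) => Z; rewrite mxE.
have [B1 B1n] : exists B : 'M[F]_(l, n), seg B != 0.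
  by exists (color_mx F (@block_color k l)); apply: seg_color_neq0.
have fE B : primal_eval f B = QE B * seg B.
  by rewrite -mxeval_in_primal_coords // fQ /mxeval mevalM -/(mxeval (segre_poly A)
    B) mxeval_segre_poly.
have semi (Z : 'M[F]_(l, l + n)) : QE (lsubmx Z *m rsubmx Z) * \det (lsubmx Z) ^+ k -
    \det (lsubmx Z) ^+ e * QE (rsubmx Z) = 0.
  move: Z; apply: (polyfun_mul_eq0 _ (polyfun_row_mx l polyfun_seg)).
  - by apply: polyfunB; apply: polyfunM => //; apply: polyfunX.
  - move=> Z; rewrite mulrBl -mulrA -seg_mulmx -fE -mulrA -fE.
    by rewrite (primal_eval_mulmx mln) (meval_dhomog _ _ fh) subrr.
  - by exists (row_mx 0 B1); rewrite row_mxKr.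
have det1n (c : nat) d : exists Z : 'M[F]_(l, l + c), \det (lsubmx Z) ^+ d != 0.
  by exists (row_mx 1%:M 0); rewrite row_mxKl det1 expr1n oner_neq0.
have [ke|ek] := leqP k e.
  have inv (Y : 'M[F]_l) B : QE (Y *m B) = \det Y ^+ (e - k) * QE B.
    have := polyfun_mul_eq0 (polyfunB pQY (polyfunM (polyfunX (e - k) (pdet n)) pQ))
      (polyfunX k (pdet n)) _ (det1n n k) (row_mx Y B).
    rewrite row_mxKl row_mxKr => H; apply/eqP; rewrite -subr_eq0; apply/eqP/H => Z.
    have := semi Z; rewrite -{1}(subnK ke) exprD => S.
    by rewrite mulrBl -[X in _ - X]mulrAC.
  have [q qE] := first_fundamental_theorem mln (polyfun_mxeval Q) inv.
  by exists q; apply: mxeval_eq => B; rewrite mxeval_in_primal_coords // -qE.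
exists 0; rewrite /in_primal_coords comp_mpoly0; apply: mxeval_eq => B.
rewrite {1}/mxeval meval0.
have := polyfun_mul_eq0 (polyfunB (polyfunM pQY (polyfunX (k - e) (pdet n))) pQ)
  (polyfunX e (pdet n)) _ (det1n n e) (row_mx 0 B).
rewrite row_mxKl row_mxKr => H; suff /H : forall Z : 'M[F]_(l, l + n),
    (QE (lsubmx Z *m rsubmx Z) * \det (lsubmx Z) ^+ (k - e) - QE (rsubmx Z)) *
    \det (lsubmx Z) ^+ e = 0.
  rewrite det_mx0 // expr0n subn_eq0 leqNgt ek mulr0 sub0r => /eqP.
  by rewrite oppr_eq0 /QE => /eqP ->.
move=> Z; by rewrite mulrBl -mulrA -exprD subnK ?(ltnW ek) // [X in _ - X]mulrC semi.
Qed.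

(** Semi-invariance of the quotient needs a fixed degree, so f is divided component by component and
    the quotients are added. *)
Lemma vanishes_on_orbitP f0 f : in_primal_coords l f0 = segre_poly A ->
  vanishes_on_orbit f <-> exists q, coord_eq f (q * f0).
Proof.
move=> f0E; split=> [fO|[q /(coord_eqP mln l0 m0) fq]]; last first.
  move=> B t Bf t0 AtB; rewrite -mxeval_in_primal_coords // fq in_primal_coordsM.
  rewrite /mxeval mevalM -!/(mxeval _ _) mxeval_in_primal_coords //.
  rewrite [X in _ * X](_ : _ = 0) ?mulr0 // f0E mxeval_segre_poly.
  move/khatri_rao_kernel: AtB => ker; apply/eqP; rewrite -det_tr; apply/det0P.
  exists t; last by rewrite -[t]trmxK -trmx_mul ker trmx0.
  apply/eqP => t00; have h : 'I_n by exists 0%N; rewrite muln_gt0 k0.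
  by have := t0 h; rewrite t00 mxE eqxx.
have H (e : 'I_(msize f)) : exists q, coord_eq (pihomog mdeg e f) (q * f0).
  have [Q QE] : exists Q, in_primal_coords l (pihomog mdeg e f) = Q * segre_poly A.
    apply: (segre_poly_dvd k2 l2 A_generic) => B t Bf t0 AtB.
    rewrite mxeval_in_primal_coords //.
    exact: (vanishes_on_orbit_pihomog e fO Bf t0 AtB).
  have [q qE] := semi_invariant_quotient (pihomogP _ e f) QE.
  by exists q; apply/(coord_eqP mln l0 m0); rewrite in_primal_coordsM qE f0E.
have [q qE] := fin_all_exists H; exists (\sum_e q e).
apply/(coord_eqP mln l0 m0).
rewrite [f in LHS](pihomog_partitionE (leqnn (msize f))) in_primal_coordsM.
rewrite /in_primal_coords !raddf_sum mulr_suml; apply: eq_bigr => e _ /=.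
by have /(coord_eqP mln l0 m0) := qE e; rewrite in_primal_coordsM.
Qed.

(** As k + l <= k l, the annihilator of A has l independent rows. With t = 1 this witnesses that the
    locus is non-empty. *)
Lemma exists_orbit_annihilator : exists B : 'M[F]_(l, n), row_free B /\ B *m A^T = 0.
Proof.
have kn : (k <= n)%N by rewrite leq_pmulr.
have Af := generic_row_free A_generic kn.
have [K Kf KA] := exists_annihilator (subnKC kn) Af.
have lnk : (l <= n - k)%N.
  by rewrite leq_subRL // leq_add_mul.
exists (pid_mx l *m K); split; last by rewrite -mulmxA KA mulmx0.
by rewrite /row_free mxrankMfree // rank_pid_mx.
Qed.

(* The pairs (B, t) with [A diag(t) B^T = 0] and t in the torus are
   parametrized by an affine space: [B = N K diag(u)], [u = 1/t], where the
   rows of K span the kernel of A. *)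
Lemma vanishes_on_orbitM f g :
  vanishes_on_orbit (f * g) -> vanishes_on_orbit f \/ vanishes_on_orbit g.
Proof.
move=> fgO; pose K := kermx A^T.
pose par (Z : 'M[F]_(l + 1, n)) := usubmx Z *m K *m diag_mx (dsubmx Z).
have ppar i j : polyfun (fun Z => par Z i j).
  have pu a b : polyfun (fun Z : 'M[F]_(l + 1, n) => usubmx Z a b).
    by apply: eq_polyfun (polyfun_entry _ (lshift 1 a) b) => Z; rewrite mxE.
  have pd b : polyfun (fun Z : 'M[F]_(l + 1, n) => dsubmx Z 0 b).
    by apply: eq_polyfun (polyfun_entry _ (rshift l 0) b) => Z; rewrite mxE.
  have pK a b : polyfun (fun Z : 'M[F]_(l + 1, n) => K a b) by apply: polyfun_cst.
  apply: eq_polyfun (polyfunM (polyfun_mulmx pu pK i j) (pd j)) => Z.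
  by rewrite /par mul_mx_diag [RHS]mxE.
have AK : A *m K^T = 0 by apply: trmx_inj; rewrite trmx_mul trmxK trmx0 mulmx_ker.
have parK (Z : 'M[F]_(l + 1, n)) (t : 'rV[F]_n) :
  (forall h, t 0 h * dsubmx Z 0 h = 1) ->
    A *m diag_mx t *m (par Z)^T = 0.
  move=> tu; rewrite /par trmx_mul (trmx_mul _ K) tr_diag_mx !mulmxA -(mulmxA A).
  rewrite (_ : diag_mx t *m _ = 1%:M) ?mulmx1; last first.
    by apply/matrixP => a b; rewrite mul_mx_diag !mxE; case: eqP => [->|];
      rewrite ?mulr1n ?mulr0n ?mul0r // -(tu b) !mxE.
  by rewrite AK mul0mx.
have onpar f' : vanishes_on_orbit f' -> forall Z, primal_eval f' (par Z) = 0.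
  move=> f'O; have [B1 [B1f B1A]] := exists_orbit_annihilator.
  have [h hu] := exists_pivot B1f.
  (* Where this product is non-zero, [par Z] has full rank and u lies in the torus. It is non-zero
     at u = 1 and N with [B1 = N *m K]. *)
  have pD : polyfun (fun Z : 'M[F]_(l + 1, n) =>
    \det (colsub h (par Z)) * \prod_i dsubmx Z 0 i).
    apply: polyfunM.
      by apply: polyfun_det => i j; apply: eq_polyfun (ppar i (h j)) => Z;
        rewrite [RHS]mxE.
    apply: polyfun_prod => i.
    by apply: eq_polyfun (polyfun_entry _ (rshift l 0) i) => Z; rewrite mxE.
  apply: (polyfun_mul_eq0 (polyfun_comp (polyfun_primal_eval mln f') ppar) pD).
    move=> Z; case: (eqVneq (\det (colsub h (par Z))) 0) => [->|d0];
      first by rewrite mul0r mulr0.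
    case: (eqVneq (\prod_i dsubmx Z 0 i) 0) => [->|/prodf_neq0 u0];
      first by rewrite !mulr0.
    rewrite (f'O _ (\row_i (dsubmx Z 0 i)^-1)) ?mul0r //.
    - exact: row_free_colsub d0.
    - by move=> i; rewrite mxE invr_eq0 u0.
    - by apply: parK => i; rewrite mxE mulVf ?u0.
  have /submxP[N NE] : (B1 <= K)%MS by apply/sub_kermxP.
  exists (col_mx N (const_mx 1)); rewrite /par col_mxKu col_mxKd -NE.
  rewrite (_ : diag_mx _ = 1%:M) ?mulmx1; last first.
    by apply/matrixP => a b; rewrite !mxE.
  rewrite mulf_neq0 //; first by rewrite -unitfE -unitmxE.
  by apply/prodf_neq0 => i _; rewrite mxE oner_eq0.
(* Conversely every admissible (B, t) is reached: the rows of B diag(t) lie in the row space of K,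
   and u = 1/t undoes the scaling. *)
have parO f' : (forall Z, primal_eval f' (par Z) = 0) -> vanishes_on_orbit f'.
  move=> f'0 B t Bf t0 AtB.
  have /submxP[N NE] : (B *m diag_mx t <= K)%MS.
    by apply/sub_kermxP; rewrite -[A]trmxK -[B]trmxK -[diag_mx t]tr_diag_mx
      -!trmx_mul trmxK mulmxA AtB trmx0.
  pose u := \row_i (t 0 i)^-1; rewrite -(f'0 (col_mx N u)) /par col_mxKu col_mxKd -NE.
  rewrite -mulmxA (_ : _ *m diag_mx u = 1%:M) ?mulmx1 //.
  apply/matrixP => a b; rewrite mul_mx_diag !mxE; case: eqP => [->|].
    by rewrite !mulr1n divff.
  by rewrite !mulr0n mul0r.
have [gz|gn] := boolp.pselect (forall Z, primal_eval g (par Z) = 0).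
  by right; apply: parO.
left; apply: parO; apply: (polyfun_mul_eq0
  (polyfun_comp (polyfun_primal_eval mln f) ppar)
  (polyfun_comp (polyfun_primal_eval mln g) ppar)).
  by move=> Z; rewrite -primal_evalM; apply: onpar.
apply: boolp.contrapT => H; apply: gn => Z; apply/eqP/negPn/negP => Zn.
by apply: H; exists Z.
Qed.

Local Notation CL := (zclosure locus).

(** The circle closes through seg: vanishing on the orbit gives a multiple of seg, and seg vanishes
    on the locus, limit points included. *)
Lemma locus_idealP f : vanishing_ideal CL f <-> vanishes_on_orbit f.
Proof.
rewrite vanishing_zclosure; split; first exact: vanishes_on_orbit_locus.
have [f0 f0E] := exists_segre_plucker.
move/(vanishes_on_orbitP _ f0E) => [q fq]; apply: coord_eq_vanishing fq _.
exact/vanishing_ideal_mull/segre_vanishes_locus.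
Qed.

Lemma segre_poly_neq0 : segre_poly A != 0.
Proof.
apply/eqP => s0; have := mxeval_segre_poly A (color_mx F (@block_color k l)).
rewrite s0 /mxeval meval0 => /esym/eqP; apply/negP.
exact: seg_color_neq0.
Qed.

Lemma msize_segre_poly : (1 < msize (segre_poly A))%N.
Proof.
rewrite ltnNge; apply/negP => /msize1_polyC sE; case/eqP: segre_poly_neq0.
rewrite sE; have := mxeval_segre_poly A 0.
rewrite {1}sE /mxeval mevalC => ->; rewrite (_ : khatri_rao A 0 = 0).
  by rewrite det_mx0 // muln_gt0 k0.
by apply/matrixP => i j; rewrite !mxE mulr0.
Qed.

Lemma locus_irreducible : irreducible_closed CL.
Proof.
apply: prime_irreducible; first exact: zclosure_closed.
  (* On an empty locus the constant 1 would vanish, contradicting its value at an annihilator of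
     A. *)
  apply: boolp.contrapT => empty.
  have /locus_idealP one : vanishing_ideal CL 1 by move=> U UZ; case: empty; exists U.
  have [B [Bf BA]] := exists_orbit_annihilator.
  have e1 : primal_eval (1 : plucker_poly F m n) B = 1 by apply: meval1.
  case/eqP: (oner_neq0 F); rewrite -e1; apply: (one B (const_mx 1) Bf) => [h|];
    first by rewrite mxE oner_eq0.
  rewrite (_ : diag_mx _ = 1%:M) ?mulmx1.
    by rewrite -[A]trmxK -trmx_mul BA trmx0.
  by apply/matrixP => a b; rewrite !mxE.
by move=> f g; rewrite !locus_idealP => /vanishes_on_orbitM.
Qed.

(** Descent on the degree: g = q f0 as W contains the locus, and primality puts q in the ideal of W.
    Its degree is smaller because seg is not constant. *)
Lemma irreducible_above_locus (W : set (Gr F m n)) f0 :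
  in_primal_coords l f0 = segre_poly A ->
  irreducible_closed W -> (CL `<=` W)%classic -> ~ vanishing_ideal W f0 ->
  forall g, vanishing_ideal W g -> in_primal_coords l g = 0.
Proof.
move=> f0E Wirr ZW nf0 g; have [s] := ubnP (msize (in_primal_coords l g)).
elim: s g => // s IH g lt_s gW.
have /locus_idealP/(vanishes_on_orbitP _ f0E)[q gq] : vanishing_ideal CL g.
  by move=> U /ZW /gW.
have [|qW|//] := irreducible_prime m0 Wirr (f := q) (g := f0).
  exact: coord_eq_vanishing (coord_eq_sym gq) gW.
have /(coord_eqP mln l0 m0) := gq; rewrite in_primal_coordsM f0E => E.
case: (eqVneq (in_primal_coords l q) 0) => [q0|qn]; first by rewrite E q0 mul0r.
rewrite E IH ?mul0r //; move: lt_s; rewrite E msizeM ?segre_poly_neq0 //.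
have := msize_segre_poly; case: (msize (segre_poly A)) => [|[|a]] // _.
by rewrite !addnS /= ltnS; apply: leq_ltn_trans; apply: leq_addr.
Qed.

Lemma locus_hypersurface : hypersurface CL.
Proof.
have [f0 f0E] := exists_segre_plucker.
have f0Z : vanishing_ideal CL f0.
  by apply/vanishing_zclosure; apply: segre_vanishes_locus.
have irr := locus_irreducible; have [clZ nZ _] := irr.
split=> // W [Wirr WZ Wmax]; have <- : CL = W by apply: Wmax.
split=> // [ZT|W' W'irr ZW'].
  case/eqP: segre_poly_neq0; rewrite -f0E.
  by apply/(vanishing_setTP mln l0 m0) => U UT; apply: f0Z; rewrite ZT.
have [clW' _ _] := W'irr.
(* If f0 vanishes on W', so does the whole ideal of the locus, and W' is the locus; if not, the
   ideal of W' is zero and W' is everything. *)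
have [f0W|nf0] := boolp.pselect (vanishing_ideal W' f0); [left | right].
  apply/boolp.funext => U; apply/boolp.propext; split=> [UW|/ZW' //].
  rewrite -clZ => g /locus_idealP/(vanishes_on_orbitP _ f0E)[q gq].
  exact: (coord_eq_vanishing gq (vanishing_ideal_mull q f0W)) UW.
apply/boolp.funext => U; apply/boolp.propext; split=> // _; rewrite -clW' => g gW.
have /(vanishing_setTP mln l0 m0) := irreducible_above_locus f0E W'irr ZW' nf0 gW.
by apply.
Qed.

Lemma segre_generates_locus f0 g : in_primal_coords l f0 = segre_poly A ->
  vanishing_ideal CL g <-> exists q, coord_eq g (q * f0).
Proof. by move=> f0E; rewrite locus_idealP; apply: vanishes_on_orbitP. Qed.

(** Two generators divide each other, and after cancelling seg the quotients multiply to 1 in a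
    polynomial ring, so their degrees are zero. *)
Lemma locus_generator_unique f :
  (forall g, vanishing_ideal CL g <-> exists q, coord_eq g (q * f)) ->
  exists2 c : F, c != 0 & in_primal_coords l f = c *: segre_poly A.
Proof.
move=> fgen; have [f0 f0E] := exists_segre_plucker.
have [q /(coord_eqP mln l0 m0)] : exists q, coord_eq f (q * f0).
  apply/(segre_generates_locus _ f0E)/fgen; exists 1.
  by apply/(coord_eqP mln l0 m0); rewrite mul1r.
rewrite in_primal_coordsM f0E => fE.
have [q' /(coord_eqP mln l0 m0)] : exists q', coord_eq f0 (q' * f).
  apply/fgen/(segre_generates_locus _ f0E); exists 1.
  by apply/(coord_eqP mln l0 m0); rewrite mul1r.
rewrite in_primal_coordsM f0E fE mulrA -[X in X = _]mul1r.
move=> /(mulIf segre_poly_neq0) /esym qq.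
have nq : in_primal_coords l q != 0 by apply: contra_eq_neq qq => ->;
  rewrite mulr0 eq_sym oner_neq0.
have nq' : in_primal_coords l q' != 0 by apply: contra_eq_neq qq => ->;
  rewrite mul0r eq_sym oner_neq0.
have /msize_poly1P[c c0 qc] : msize (in_primal_coords l q) == 1%N.
  have : msize (in_primal_coords l q * in_primal_coords l q') = 1%N.
    by rewrite mulrC qq -mpolyC1 msizeC oner_neq0.
  rewrite msizeM //; move: nq nq'; rewrite -!msize_poly_eq0.
  by case: (msize _) => // a _; case: (msize _) => // b _; rewrite addnS => -[];
    case: a; case: b.
by exists c => //; rewrite qc mul_mpolyC.
Qed.

End ChowLam.

Theorem theorem1p2 (R : realType) (k l : nat) (A : 'M[R[i]]_(k, k * l)) :
  (2 <= k)%N -> (2 <= l)%N ->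
  (forall I : {set 'I_(k * l)}, #|I| = k -> minor A I != 0) ->
  (exists f, is_chow_lam_form (r := k + l) (torus_orbit_closure A) f) /\
  (forall f, is_chow_lam_form (r := k + l) (torus_orbit_closure A) f ->
     exists2 c : R[i], c != 0 & in_primal_coords l f = c *: segre_poly A).
Proof.
move=> k2 l2 A_generic.
(* The point dimension n - r + k with r = k + l is a truncated subtraction; k + l <= k l makes it
   complementary to l. *)
have mln : (k * l - (k + l) + k + l = k * l)%N by rewrite -addnA subnK ?leq_add_mul.
split=> [|f].
  have [f0 f0E] := exists_segre_plucker A mln.
  exists f0; left; split; first exact: locus_hypersurface.
  by move=> g; apply: segre_generates_locus.
case=> -[H G]; first exact: locus_generator_unique.
(* The default form 1 is excluded because the locus is a hypersurface. *)
by case: H; apply: locus_hypersurface.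
Qed.
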